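(* For every constant $k \ge 0$, the class $k$-$\mathsf{LCL}$ of languages decidable by $k$-lossy catalytic Turing machines using $O(\log n)$ work space and $2^{O(\log n)}$ auxiliary space equals $\mathsf{CL}$, the class of languages decidable by deterministic catalytic Turing machines using $O(\log n)$ work space and $2^{O(\log n)}$ auxiliary space.
   Context: A deterministic catalytic Turing machine using work space $s(n)$ and auxiliary space $s_a(n)$ is a deterministic Turing machine $\mathcal{M}$ with a read-only input tape, a work tape, and an auxiliary tape, such that for all inputs $x \in \{0,1\}^n$ and all initial auxiliary tape contents $w \in \{0,1\}^{s_a(n)}$: (1) $\mathcal{M}$ uses at most $s(n)$ cells of work tape and $s_a(n)$ cells of auxiliary tape; (2) (catalytic condition) $\mathcal{M}$ halts with exactly $w$ on its auxiliary tape; (3) (consistency) $\mathcal{M}$ either accepts $x$ for all choices of $w$ or rejects $x$ for all choices of $w$. $\mathsf{CSPACE}(s(n))$ is the set of languages decided by such machines with work space $s(n)$ and auxiliary space $2^{s(n)}$, and $\mathsf{CL} = \mathsf{CSPACE}(O(\log n))$. For a constant $k$, a $k$-lossy catalytic Turing machine is defined the same way except that the catalytic condition is replaced by: when started with $w$ on the auxiliary tape, it halts with some $w'$ on the auxiliary tape whose Hamming distance from $w$ (number of positions where they differ) is at most $k$ (space bound and consistency are still required). $\mathsf{LCSPACE}(s(n),k)$ is the set of languages decided by $k$-lossy catalytic machines with work space $s(n)$ and auxiliary space $2^{s(n)}$, and $k$-$\mathsf{LCL} = \mathsf{LCSPACE}(O(\log n), k)$. *)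

(* Defs.v *)
From mathcomp Require Import all_boot.

Set Implicit Arguments.
Unset Strict Implicit.
Unset Printing Implicit Defensive.

Definition language := seq bool -> Prop.

(* The input x occupies cells 1, ..., n of the read-only tape, between a left
   end marker in cell 0 and a right end marker in cell n + 1. *)
Inductive input_symbol := LeftEnd | Bit of bool | RightEnd.

Inductive move := MoveL | Stay | MoveR.

(* [verdict q = Some true] (resp. [Some false]) means that q is an accepting
   (resp. rejecting) halting state; [None] means that q is not halting.
   The work alphabet is an arbitrary finite alphabet with a blank, the
   auxiliary alphabet is {0,1}. *)
Record machine := Machine {
  state : finType;
  work_symbol : finType;
  blank : work_symbol;
  start : state;
  verdict : state -> option bool;
  trans : state -> input_symbol -> work_symbol -> bool ->
          state * (work_symbol * bool) * (move * move * move)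
}.

(* The work and auxiliary tapes are infinite to the right, with cells
   0, 1, 2, ... *)
Record config (M : machine) := Config {
  cstate : state M;
  input_pos : nat;
  work_pos : nat;
  work_tape : nat -> work_symbol M;
  aux_pos : nat;
  aux_tape : nat -> bool
}.

Definition read_input (x : seq bool) (i : nat) : input_symbol :=
  if i is j.+1 then
    if j < size x then Bit (nth false x j) else RightEnd
  else LeftEnd.

Definition write (T : Type) (f : nat -> T) (p : nat) (a : T) : nat -> T :=
  fun i => if i == p then a else f i.

(* A left move from cell 0 leaves the head in place. *)
Definition shift (m : move) (p : nat) : nat :=
  match m with MoveL => p.-1 | Stay => p | MoveR => p.+1 end.

Definition step (M : machine) (x : seq bool) (c : config M) : config M :=
  if verdict (cstate c) is Some _ then c else
  let: (q, (a, b), (mi, mw, ma)) :=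
    trans (cstate c) (read_input x (input_pos c))
          (work_tape c (work_pos c)) (aux_tape c (aux_pos c)) in
  @Config M q
    (minn (shift mi (input_pos c)) (size x).+1)
    (shift mw (work_pos c)) (write (work_tape c) (work_pos c) a)
    (shift ma (aux_pos c)) (write (aux_tape c) (aux_pos c) b).

(* The auxiliary tape starts with w in its first [size w] cells. The value
   given to the further cells is immaterial: the space bound below forbids
   visiting them. In particular there is no marker at the end of w. *)
Definition init (M : machine) (w : seq bool) : config M :=
  @Config M (start M) 0 0 (fun=> blank M) 0 (nth false w).

Definition run (M : machine) (x w : seq bool) (t : nat) : config M :=
  iter t (step x) (init M w).

Definition halted (M : machine) (c : config M) : Prop :=
  exists b, verdict (cstate c) = Some b.

Definition accepts (M : machine) (x w : seq bool) : Prop :=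
  exists t, verdict (cstate (run M x w t)) = Some true.

Definition rejects (M : machine) (x w : seq bool) : Prop :=
  exists t, verdict (cstate (run M x w t)) = Some false.

Definition aux_content (M : machine) (m : nat) (c : config M) : m.-tuple bool :=
  [tuple aux_tape c i | i < m].

Definition hamming (m : nat) (u v : m.-tuple bool) : nat :=
  #|[set i : 'I_m | tnth u i != tnth v i]|.

(* Both heads start in cell 0 and move by at most one cell per step, so the
   cells used on a tape are 0, ..., p where p is the largest head position. *)
Definition space_bounded (M : machine) (s sa : nat -> nat) : Prop :=
  forall (x : seq bool) (w : (sa (size x)).-tuple bool) (t : nat),
    work_pos (run M x w t) < s (size x) /\
    aux_pos (run M x w t) < sa (size x).

Definition catalytic_condition (M : machine) (sa : nat -> nat) : Prop :=
  forall (x : seq bool) (w : (sa (size x)).-tuple bool),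
  exists t, halted (run M x w t) /\
            aux_content (sa (size x)) (run M x w t) = w.

Definition lossy_condition (k : nat) (M : machine) (sa : nat -> nat) : Prop :=
  forall (x : seq bool) (w : (sa (size x)).-tuple bool),
  exists t, halted (run M x w t) /\
            hamming (aux_content (sa (size x)) (run M x w t)) w <= k.

Definition consistent (M : machine) (sa : nat -> nat) : Prop :=
  forall x : seq bool,
    (forall w : (sa (size x)).-tuple bool, accepts M x w) \/
    (forall w : (sa (size x)).-tuple bool, rejects M x w).

Definition catalytic_TM (M : machine) (s sa : nat -> nat) : Prop :=
  [/\ space_bounded M s sa, catalytic_condition M sa & consistent M sa].

Definition lossy_catalytic_TM (k : nat) (M : machine) (s sa : nat -> nat) :
    Prop :=
  [/\ space_bounded M s sa, lossy_condition k M sa & consistent M sa].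

Definition decides (M : machine) (sa : nat -> nat) (L : language) : Prop :=
  forall x : seq bool,
    L x <-> forall w : (sa (size x)).-tuple bool, accepts M x w.

Definition CSPACE (s : nat -> nat) (L : language) : Prop :=
  exists M : machine,
    catalytic_TM M s (fun n => 2 ^ s n) /\ decides M (fun n => 2 ^ s n) L.

Definition LCSPACE (s : nat -> nat) (k : nat) (L : language) : Prop :=
  exists M : machine,
    lossy_catalytic_TM k M s (fun n => 2 ^ s n) /\
    decides M (fun n => 2 ^ s n) L.

Definition O_log (s : nat -> nat) : Prop :=
  exists c n0, forall n, n0 <= n -> s n <= c * trunc_log 2 n.

Definition CL (L : language) : Prop := exists s, O_log s /\ CSPACE s L.

Definition LCL (k : nat) (L : language) : Prop :=
  exists s, O_log s /\ LCSPACE s k L.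

(* Main.v *)
Require Import Defs.
From HB Require Import structures.
From mathcomp Require Import all_boot.
From Stdlib Require Import FunctionalExtensionality.

Set Implicit Arguments.
Unset Strict Implicit.
Unset Printing Implicit Defensive.

(* A catalytic machine may take any finite time, so it can walk along the Euler
   tour of the configuration graph of a k-lossy machine M, which is reversible.
   Restrict M to T = O(log n) work cells and 2^T auxiliary cells; the
   configurations that lead to a given halting configuration h form a finite
   tree with root h. Starting at an initial configuration, the tour reaches h,
   where the verdict is read off, and is then followed backwards. The tree may
   contain several initial configurations, but each of their auxiliary tapes is
   within Hamming distance k of that of h, so there are at most (2^T + 1)^k of
   them: on the way to h their visits are counted in O(k T) bits, and on the way
   back the counter tells at which visit to stop, with the auxiliary tape
   restored. *)

(** * The Euler tour of a forest *)

(** The bound [s] need not be computable and the auxiliary tape carries no end marker, so the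
    simulator chooses its own window [T >= s n], which it can lay out from the input length. Outside
    genuine runs nothing is known about [M] on this window: it may loop or run off the edge. A move
    that would leave the window is therefore a dead end, which keeps the graph a partial function
    whose edges can be inverted locally, and only trees containing an initial configuration matter.
    These behave well because the lossy condition is assumed for every auxiliary content, hence also
    for the initial configurations met by chance. Simulating [M] and then undoing it directly would
    fail, since a configuration does not determine its predecessor; the tour instead tries all
    predecessors in a fixed cyclic order and needs no memory beyond the current vertex and port. *)

Section Ports.
Variable L : finType.

(* A vertex has the port [ord0] for the edge to its parent and one port for each
   label that the edge from a child may carry. *)
Definition port := 'I_#|L|.+1.
Definition port_of (l : L) : port := lift ord0 (enum_rank l).
Definition label_of (e : port) : option L := omap enum_val (unlift ord0 e).

Lemma port_ofK l : label_of (port_of l) = Some l.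
Proof. by rewrite /label_of /port_of liftK /= enum_rankK. Qed.

Lemma label_of0 : label_of ord0 = None.
Proof. by rewrite /label_of unlift_none. Qed.

Variant label_of_spec (e : port) : option L -> Prop :=
  | LabelNone of e = ord0 : label_of_spec e None
  | LabelSome l of e = port_of l : label_of_spec e (Some l).

Lemma label_ofP e : label_of_spec e (label_of e).
Proof.
rewrite /label_of; case: unliftP => [j|] -> /=; constructor => //.
by rewrite /port_of enum_valK.
Qed.

End Ports.

Section EulerTour.
Variables (X : Type) (L F : finType) (wf : X -> Prop) (code : X -> F).
Variables (fs : X -> option (X * L)) (bs : X -> L -> option X).
Hypothesis code_inj : forall c c', wf c -> wf c' -> code c = code c' -> c = c'.
Hypothesis fs_wf : forall c c' l, wf c -> fs c = Some (c', l) -> wf c'.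
Hypothesis bs_wf : forall c l c', wf c -> bs c l = Some c' -> wf c'.
Hypothesis fsK : forall c c' l, wf c -> fs c = Some (c', l) -> bs c' l = Some c.
Hypothesis bsK : forall c l c', wf c -> bs c l = Some c' -> fs c' = Some (c, l).

Implicit Types (c d h z : X) (e : port L) (y : X * port L) (n j : nat).

(** An absent edge fixes its port, which makes [swap] an involution on well-formed vertices.
    Composed with the cyclic rotation of ports it stays invertible. *)
Definition swap y : X * port L :=
  match label_of y.2 with
  | None => if fs y.1 is Some (c', l) then (c', port_of l) else y
  | Some l => if bs y.1 l is Some c' then (c', ord0) else y
  end.

Definition tour y := ((swap y).1, ordS (swap y).2).
Definition untour y := swap (y.1, ord_pred y.2).

Lemma swap_wf y : wf y.1 -> wf (swap y).1.
Proof.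
rewrite /swap => wy; case: label_of => [l|].
  by case E: bs => [c'|] //=; apply: bs_wf E.
by case E: fs => [[c' l]|] //=; apply: fs_wf E.
Qed.

Lemma swapK y : wf y.1 -> swap (swap y) = y.
Proof.
case: y => c e /= wc; rewrite [swap (c, e)]/swap /=.
case: label_ofP => [|l] -> /=.
  case E: fs => [[c' l]|] /=; last by rewrite /swap label_of0 /= E.
  by rewrite /swap /= port_ofK (fsK wc E).
case E: bs => [c'|] /=; last by rewrite /swap /= port_ofK E.
by rewrite /swap /= label_of0 (bsK wc E).
Qed.

Lemma tour_wf y : wf y.1 -> wf (tour y).1.
Proof. by move=> wy; apply: swap_wf. Qed.

Lemma iter_tour_wf n y : wf y.1 -> wf (iter n tour y).1.
Proof. by move=> wy; elim: n => //= n IH; apply: tour_wf. Qed.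

Lemma tourK y : wf y.1 -> untour (tour y) = y.
Proof.
move=> wy; rewrite /untour /tour /= ordSK.
by rewrite -[RHS](swapK wy); case: (swap y).
Qed.

Lemma iter_tour_inj n y y' :
  wf y.1 -> wf y'.1 -> iter n tour y = iter n tour y' -> y = y'.
Proof.
move=> wy wy'; elim: n => //= n IH E; apply: IH.
by rewrite -(tourK (iter_tour_wf n wy)) E tourK //; apply: iter_tour_wf.
Qed.

(** [code] has a finite range, so two times share a value; injectivity of the tour cancels their
    common initial part. *)
Lemma tour_period y : wf y.1 -> exists n, iter n.+1 tour y = y.
Proof.
move=> wy; pose g (i : 'I_(#|{: F * port L}|).+1) :=
  (code (iter i tour y).1, (iter i tour y).2).
have /injectivePn [i [j ij gij]] : ~~ injectiveb g.
  by apply/injectiveP => /leq_card; rewrite card_ord ltnn.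
wlog lt_ij : i j ij gij / i < j.
  move=> wl; case: (ltngtP i j) => [||/val_inj E]; first exact: wl.
    by apply: wl; rewrite // eq_sym.
  by rewrite E eqxx in ij.
have [n En] : exists n, j = i + n.+1 :> nat by exists (j - i.+1);
  rewrite addnS -addSn subnKC.
exists n; case: gij; rewrite En.
move=> /code_inj E1 E2; apply: (@iter_tour_inj i) => //; first exact: iter_tour_wf.
rewrite -iterD; apply: injective_projections; last by rewrite E2.
by rewrite E1 //; apply: iter_tour_wf.
Qed.

(** * Paths to the root, and why the tour reaches it *)

Fixpoint fwd_path n c d : Prop :=
  if n is n'.+1 then exists c' l, fs c = Some (c', l) /\ fwd_path n' c' d
  else c = d.

Definition rooted c h := fs h = None /\ exists n, fwd_path n c h.

(** [fs] is a function, so the path to a root is unique; its length serves as a depth, which rules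
    out cycles. *)
Lemma fwd_path_length n n' c h h' : fs h = None -> fs h' = None ->
  fwd_path n c h -> fwd_path n' c h' -> n = n' /\ h = h'.
Proof.
move=> Eh Eh'; elim: n n' c => [|n IH] [|n'] c /=.
- by move=> -> ->.
- by move=> Ec [c' [l [E _]]]; rewrite -Ec E in Eh.
- by move=> [c' [l [E _]]] E'; rewrite -E' E in Eh'.
- by move=> [c' [l [E P]]] [c1 [l1 [E1 P1]]]; move: E1 P1;
    rewrite E => -[<- _] /(IH _ _ P) [-> ->].
Qed.

Lemma fwd_path_trans n n' c d h : fwd_path n c d -> fwd_path n' d h -> fwd_path
  (n + n') c h.
Proof.
elim: n c => [|n IH] c /=; first by move->.
by move=> [c' [l [E P]]] P'; exists c', l; split=> //; apply: IH.
Qed.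

Lemma rooted_step c c' l h : fs c = Some (c', l) -> rooted c h <-> rooted c' h.
Proof.
move=> E; split=> -[Eh [n P]]; split=> //.
  case: n P => [|n] /= P; first by rewrite P Eh in E.
  by case: P => [c1 [l1 []]]; rewrite E => -[<- _] P; exists n.
by exists n.+1, c', l.
Qed.

Lemma rooted_tour y h : wf y.1 -> rooted y.1 h -> rooted (tour y).1 h.
Proof.
case: y => c e /= wc R; rewrite /tour /swap /=; case: label_of => [l|].
  by case E: bs => [c'|] //=; apply/(rooted_step _ (bsK wc E)).
by case E: fs => [[c' l]|] //=; apply/(rooted_step _ E).
Qed.

Lemma iter_rooted_tour n y h :
  wf y.1 -> rooted y.1 h -> rooted (iter n tour y).1 h.
Proof.
move=> wy R; elim: n => //= n IH; apply: rooted_tour => //.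
exact: iter_tour_wf.
Qed.

(* The tour enters the subtree below [d] at [d] and, being periodic, must leave
   it; the only exit is the port [ord0] of [d]. *)
Lemma tour_leaves n z e d c e0 : wf z ->
  (exists j, fwd_path j z d) -> (forall j, ~ fwd_path j c d) ->
  iter n tour (z, e) = (c, e0) -> exists n', iter n' tour (z, e) = (d, ord0).
Proof.
move=> wz [j P] nP; elim: n z e j wz P => [|n IH] z e j wz P.
  by case=> E _; rewrite E in P; case: (nP _ P).
rewrite iterSr => E.
have step z' e' : tour (z, e) = (z', e') -> (exists j, fwd_path j z' d) ->
    exists n', iter n' tour (z, e) = (d, ord0).
  move=> Et [j' P']; have wz' : wf z' by have := tour_wf (y := (z, e)) wz;
    rewrite Et.
  rewrite Et in E; have [n' En'] := IH _ _ _ wz' P' E.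
  by exists n'.+1; rewrite iterSr Et.
move: step; rewrite {1}/tour /swap /=; case: label_ofP => [|l] Ee.
  case: j P => [|j] /= P; first by exists 0; rewrite /= P Ee.
  case: P => [z' [l [-> P]]] /=; move/(_ _ _ erefl); apply; by exists j.
case Eb: bs => [z'|] /= /(_ _ _ erefl); apply; last by exists j.
by exists j.+1, z, l; split=> //; apply: bsK Eb.
Qed.

(** Crossing [e] enters the subtree of a child [d]. Periodicity brings the tour back to [c], outside
    that subtree, so it must pass [(d, ord0)], and the next step returns to [c] one port further. *)
Lemma tour_next_port c e h : wf c -> rooted c h -> e != ord0 ->
  exists n, iter n tour (c, e) = (c, ordS e).
Proof.
move=> wc [Eh [m Pm]] e0; case: (label_ofP e) e0 => [->|l Ee _];
  first by rewrite eqxx.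
case Eb: (bs c l) => [d|]; last first.
  by exists 1; rewrite /= /tour /swap /= Ee port_ofK /= Eb.
have Ed := bsK wc Eb; have wd := bs_wf wc Eb.
have Et : tour (c, e) = (d, ordS ord0) by rewrite /tour /swap /= Ee port_ofK Eb.
have [N] := tour_period (y := (c, e)) wc; rewrite iterSr Et => EN.
have [||n' En'] := tour_leaves (d := d) wd _ _ EN; first by exists 0.
  (* If [c] led to [d], it would have two path lengths to [h], namely [m] and [j + m.+1]. *)
  move=> j P; have Pd : fwd_path m.+1 d h by exists c, l.
  have [] := fwd_path_length Eh Eh Pm (fwd_path_trans P Pd).
  by move/eqP; rewrite -[m in m == _]add0n addnS -addSn eqn_add2r.
exists n'.+2; rewrite iterS iterSr Et En' /tour /swap /= label_of0 Ed /=.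
by rewrite Ee.
Qed.

Lemma tour_port0 c e h : wf c -> rooted c h ->
  exists n, iter n tour (c, e) = (c, ord0).
Proof.
move=> wc R; have [j] := ubnP (#|L| - e); elim: j e => // j IH e lej.
have [->|e0] := eqVneq e ord0; first by exists 0.
have [n1 E1] := tour_next_port wc R e0.
have [em|em] := eqVneq (val e) #|L|.
  exists n1; rewrite E1; congr (_, _); apply: val_inj => /=.
  by rewrite em modnn.
have lte : e < #|L| by rewrite ltn_neqAle em -ltnS ltn_ord.
have [|n2 E2] := IH (ordS e).
  rewrite /= modn_small ?ltnS // -ltnS; apply: leq_trans lej.
  by rewrite ltnS ltn_sub2l.
by exists (n2 + n1); rewrite iterD E1.
Qed.

(** Each crossing of [ord0] climbs one edge, and [tour_port0] then brings the tour to [ord0] of the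
    parent. *)
Lemma tour_root c h : wf c -> rooted c h ->
  exists n, iter n tour (c, ord0) = (h, ord0).
Proof.
move=> wc [Eh [m P]]; elim: m c wc P => [|m IH] c wc /=; first by move->; exists 0.
move=> [c' [l [E P]]]; have wc' := fs_wf wc E.
have [n1 E1] : exists n, iter n tour (c, ord0) = (c', ord0).
  have [|n En] := @tour_port0 c' (ordS (port_of l)) h wc'; first by split=> //;
    exists m.
  exists n.+1; rewrite iterSr -En; congr iter.
  by rewrite /tour /swap /= label_of0 E.
by have [n2 E2] := IH _ wc' P; exists (n2 + n1); rewrite iterD E1.
Qed.

End EulerTour.

(** * The truncated configuration graph *)

(* [Some true] is a move to the right, [Some false] one to the left. *)
Definition dir := option bool.
Definition dirs := (dir * dir * dir)%type.

Definition dshift (d : dir) (p : nat) : nat :=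
  match d with None => p | Some true => p.+1 | Some false => p.-1 end.
Definition dmove (d : dir) : move :=
  match d with None => Stay | Some true => MoveR | Some false => MoveL end.
Definition opp (d : dir) : dir := omap negb d.
Definition opps (ds : dirs) : dirs := (opp ds.1.1, opp ds.1.2, opp ds.2).
Definition stay : dirs := (None, None, None).

Definition can_move (d : dir) (lo hi : bool) : bool :=
  match d with None => true | Some true => ~~ hi | Some false => ~~ lo end.

(** A move blocked by a tape end is recorded as no move, because a recorded move must have an exact
    reverse. *)
Definition eff_dir (m : move) (lo hi : bool) : dir :=
  match m with
  | MoveL => if lo then None else Some false
  | Stay => None
  | MoveR => if hi then None else Some true
  end.

Definition is_left_end (i : input_symbol) := if i is LeftEnd then true else false.
Definition is_right_end (i : input_symbol) := if i is RightEnd then true else false.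

Lemma oppsK : involutive opps.
Proof. by case=> [[[[]|] [[]|]] [[]|]]. Qed.

Lemma can_move_eff m lo hi : can_move (eff_dir m lo hi) lo hi.
Proof. by case: m lo hi => [] [] []. Qed.

Lemma write_id T (f : nat -> T) p : write f p (f p) = f.
Proof. by apply: functional_extensionality => i; rewrite /write;
  case: eqP => [->|]. Qed.

Lemma write_write T (f : nat -> T) p a b : write (write f p a) p b = write f p b.
Proof. by apply: functional_extensionality => i; rewrite /write; case: eqP. Qed.

Lemma write_same T (f : nat -> T) p a : write f p a p = a.
Proof. by rewrite /write eqxx. Qed.

Section Graph.
Variables (M : machine) (x : seq bool) (T : nat) (bey : nat -> bool).
Notation Q := (state M).
Notation G := (work_symbol M).
Notation n := (size x).
Implicit Types (c : config M) (ds : dirs).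

(* Whether the work head is at cell 0, at the last cell; the same for the
   auxiliary head. *)
Definition flags := (bool * bool * bool * bool)%type.

Definition legal (i : input_symbol) (fl : flags) (ds : dirs) : bool :=
  let: (w0, w1, a0, a1) := fl in
  [&& can_move ds.1.1 (is_left_end i) (is_right_end i), can_move ds.1.2 w0 w1
    & can_move ds.2 a0 a1].

(** The right ends of the work and auxiliary windows do not clamp, as [M] itself would proceed
    there; [legal] makes such a move a missing edge. *)
Definition fwd (q : Q) (i : input_symbol) (a : G) (b : bool) (fl : flags) :
    option (Q * (G * bool) * dirs) :=
  if verdict q is Some _ then None else
  let: (w0, w1, a0, a1) := fl in
  let: (q', ab, (mi, mw, ma)) := trans q i a b in
  let ds := (eff_dir mi (is_left_end i) (is_right_end i), eff_dir mw w0 false,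
             eff_dir ma a0 false) in
  if legal i fl ds then Some (q', ab, ds) else None.

Definition isym c := read_input x (input_pos c).
Definition wsym c := work_tape c (work_pos c).
Definition abit c := aux_tape c (aux_pos c).
Definition flags_of c : flags :=
  (work_pos c == 0, (work_pos c).+1 == T,
   aux_pos c == 0, (aux_pos c).+1 == 2 ^ T).

Definition act (r : Q * (G * bool) * dirs) c : config M :=
  Config r.1.1 (dshift r.2.1.1 (input_pos c))
    (dshift r.2.1.2 (work_pos c)) (write (work_tape c) (work_pos c) r.1.2.1)
    (dshift r.2.2 (aux_pos c)) (write (aux_tape c) (aux_pos c) r.1.2.2).

(** A label stores what a step destroys: the old state, the overwritten symbols and the effective
    moves. It determines the predecessor. *)
Definition edge := (Q * (G * bool) * dirs)%type.

Definition fs c : option (config M * edge) :=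
  if fwd (cstate c) (isym c) (wsym c) (abit c) (flags_of c) is Some r then
    Some (act r c, (cstate c, (wsym c, abit c), r.2))
  else None.

Definition shift_back c ds := act (cstate c, (wsym c, abit c), opps ds) c.

Definition undoes (l : edge) (q : Q) (i : input_symbol) (a : G) (b : bool)
    (fl : flags) : bool :=
  fwd l.1.1 i l.1.2.1 l.1.2.2 fl == Some (q, (a, b), l.2).

(** Whether the candidate predecessor really steps to [c] depends on cells scanned only after the
    heads have moved back, hence the two tests. *)
Definition bs c (l : edge) : option (config M) :=
  if legal (isym c) (flags_of c) (opps l.2) then
    let c1 := shift_back c l.2 in
    if undoes l (cstate c1) (isym c1) (wsym c1) (abit c1) (flags_of c1)
    then Some (act (l.1, stay) c1) else None
  else None.

(* [bey] is the fixed content of the auxiliary cells that M never visits. *)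
Definition wf c : Prop :=
  [/\ input_pos c <= n.+1, work_pos c < T, aux_pos c < 2 ^ T,
      forall j, T <= j -> work_tape c j = blank M
    & forall j, 2 ^ T <= j -> aux_tape c j = bey j].

Definition bounded c := [/\ input_pos c <= n.+1, work_pos c < T & aux_pos c < 2 ^
  T].

Lemma wf_bounded c : wf c -> bounded c.
Proof. by case. Qed.

Lemma is_left_end_isym c : is_left_end (isym c) = (input_pos c == 0).
Proof. by rewrite /isym; case: (input_pos c) => //= i; case: ifP. Qed.

Lemma is_right_end_isym c : bounded c -> is_right_end (isym c) =
  (input_pos c == n.+1).
Proof.
case; rewrite /isym; case: (input_pos c) => //= i; rewrite ltnS eqSS => le_in _ _.
by rewrite ltn_neqAle le_in andbT; case: eqP.
Qed.

Lemma can_moveK d p hi : p <= hi -> can_move d (p == 0) (p == hi) ->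
  [/\ dshift d p <= hi, dshift (opp d) (dshift d p) = p
    & can_move (opp d) (dshift d p == 0) (dshift d p == hi)].
Proof.
case: d => [[]|] //=; case: p => [|p] //= le_p.
- by move=> nh; split=> //; rewrite ltn_neqAle nh.
- by move=> nh; split=> //; rewrite ltn_neqAle nh.
- by move=> _; split=> //; [apply: ltnW | rewrite neq_ltn le_p].
Qed.

Lemma can_move_lt d p hi : p < hi -> can_move d (p == 0) (p.+1 == hi) ->
  [/\ dshift d p < hi, dshift (opp d) (dshift d p) = p
    & can_move (opp d) (dshift d p == 0) ((dshift d p).+1 == hi)].
Proof. by case: hi => // hi; rewrite !ltnS !eqSS => *; apply: can_moveK. Qed.

Lemma legalP c ds : bounded c -> legal (isym c) (flags_of c) ds ->
  [/\ can_move ds.1.1 (input_pos c == 0) (input_pos c == n.+1),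
      can_move ds.1.2 (work_pos c == 0) ((work_pos c).+1 == T)
    & can_move ds.2 (aux_pos c == 0) ((aux_pos c).+1 == 2 ^ T)].
Proof. by move=> bc; rewrite /legal /flags_of is_left_end_isym is_right_end_isym //
  => /and3P. Qed.

Lemma act_bounded r c : bounded c -> legal (isym c) (flags_of c) r.2 ->
  bounded (act r c).
Proof.
move=> bc /(legalP bc) [Li Lw La]; case: (bc) => Bi Bw Ba; split=> /=.
- by have [] := can_moveK Bi Li.
- by have [] := can_move_lt Bw Lw.
- by have [] := can_move_lt Ba La.
Qed.

Lemma legal_act r c : bounded c -> legal (isym c) (flags_of c) r.2 ->
  legal (isym (act r c)) (flags_of (act r c)) (opps r.2).
Proof.
move=> bc lg; have bc' := act_bounded bc lg.
move: lg => /(legalP bc) [Li Lw La]; case: (bc) => Bi Bw Ba.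
rewrite /legal /flags_of is_left_end_isym is_right_end_isym //=; apply/and3P; split.
- by have [] := can_moveK Bi Li.
- by have [] := can_move_lt Bw Lw.
- by have [] := can_move_lt Ba La.
Qed.

Lemma act_wf r c : wf c -> legal (isym c) (flags_of c) r.2 -> wf (act r c).
Proof.
move=> wc lg; have [? ? ?] := act_bounded (wf_bounded wc) lg.
case: wc => _ Bw Ba Hw Ha; split=> // j lej /=; rewrite /write.
  by case: eqP => [E|_]; [rewrite -E ltnNge lej in Bw | apply: Hw].
by case: eqP => [E|_]; [rewrite -E ltnNge lej in Ba | apply: Ha].
Qed.

Lemma act_stay_id c : act (cstate c, (wsym c, abit c), stay) c = c.
Proof. by rewrite /act /= !write_id; case: c. Qed.

Lemma act_stay_act r r' c : act r (act (r', stay) c) = act r c.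
Proof. by rewrite /act /= !write_write. Qed.

Lemma shift_back_act r c : bounded c -> legal (isym c) (flags_of c) r.2 ->
  shift_back (act r c) r.2 = act (r.1, stay) c.
Proof.
move=> bc /(legalP bc) [Li Lw La]; case: (bc) => Bi Bw Ba.
rewrite /shift_back {1}/act /= /wsym /abit /= !write_id /act /=.
have [_ -> _] := can_moveK Bi Li; have [_ -> _] := can_move_lt Bw Lw.
by have [_ -> _] := can_move_lt Ba La.
Qed.

Lemma shift_backK c ds : bounded c -> legal (isym c) (flags_of c) (opps ds) ->
  let c1 := shift_back c ds in
  act (cstate c1, (wsym c1, abit c1), ds) c1 = c.
Proof.
move=> bc lg c1; rewrite -[RHS]act_stay_id.
rewrite -(@shift_back_act (cstate c, (wsym c, abit c), opps ds) c bc lg).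
by rewrite [RHS]/shift_back oppsK.
Qed.

Lemma fwd_legal q i a b fl r : fwd q i a b fl = Some r -> legal i fl r.2.
Proof.
rewrite /fwd; case: verdict => //; case: fl => [[[w0 w1] a0] a1].
by case: trans => [[q' ab] [[mi mw] ma]]; case: ifP => // lg [<-].
Qed.

Lemma fs_wf c c' l : wf c -> fs c = Some (c', l) -> wf c'.
Proof.
rewrite /fs; case E: fwd => [r|] // wc [<- _]; apply: act_wf => //.
exact: fwd_legal E.
Qed.

Lemma bs_wf c l c' : wf c -> bs c l = Some c' -> wf c'.
Proof.
rewrite /bs; case: ifP => // lg wc; case: ifP => // _ [<-].
by apply: act_wf; [apply: act_wf | rewrite /legal /flags_of].
Qed.

Lemma fsK c c' l : wf c -> fs c = Some (c', l) -> bs c' l = Some c.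
Proof.
rewrite /fs; case E: fwd => [r|] // wc [<- <-].
have bc := wf_bounded wc; have lg := fwd_legal E.
rewrite /bs (legal_act bc lg) (shift_back_act bc lg).
rewrite act_stay_act act_stay_id.
rewrite /undoes /isym /flags_of /wsym /abit /= !write_same.
move: E; rewrite /isym /flags_of /wsym /abit => ->.
by case: r {lg} => [[q [a b]] ds] /=; rewrite eqxx.
Qed.

Lemma bsK c l c' : wf c -> bs c l = Some c' -> fs c' = Some (c, l).
Proof.
rewrite /bs; case: ifP => // lg wc; case: ifP => // E [<-].
have bc := wf_bounded wc.
move: E; set c1 := shift_back c l.2; rewrite /undoes => /eqP E.
rewrite /fs; rewrite /isym /flags_of /wsym /abit /= !write_same.
move: E; rewrite /isym /flags_of => ->; rewrite act_stay_act.
rewrite (shift_backK bc lg).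
by case: l @c1 {lg} => [[q0 [a0 b0]] ds].
Qed.

Lemma dshift_eff_clamp m p : p <= n.+1 ->
  dshift (eff_dir m (p == 0) (p == n.+1)) p = minn (shift m p) n.+1.
Proof.
case: m => /= le_p.
- by case: p le_p => //= p le_p; rewrite (minn_idPl (ltnW le_p)).
- by rewrite (minn_idPl le_p).
- case: eqP => [->|/eqP ne] /=; first by rewrite (minn_idPr (leqnSn _)).
  by rewrite (minn_idPl _) // ltn_neqAle ne.
Qed.

Lemma dshift_eff m p : dshift (eff_dir m (p == 0) false) p = shift m p.
Proof. by case: m => //=; case: p. Qed.

Lemma fs_verdict c v : verdict (cstate c) = Some v -> fs c = None.
Proof. by rewrite /fs /fwd => ->. Qed.

Lemma fs_Some c c' l : wf c -> fs c = Some (c', l) ->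
  verdict (cstate c) = None /\ c' = step x c.
Proof.
move=> wc; have bc := wf_bounded wc; case: (bc) => Bi _ _.
rewrite /fs /fwd /step; case: verdict => //.
rewrite /flags_of is_left_end_isym is_right_end_isym // /isym /wsym /abit.
case: trans => [[q' [a b]] [[mi mw] ma]]; case: ifP => // _ [<- _]; split=> //.
by rewrite /act /= dshift_eff_clamp // !dshift_eff.
Qed.

(** [legal] can fail only at a right end of the window, and there the step itself leaves the
    window. *)
Lemma step_fs c : wf c -> verdict (cstate c) = None ->
  work_pos (step x c) < T -> aux_pos (step x c) < 2 ^ T ->
  exists l, fs c = Some (step x c, l).
Proof.
move=> wc vc; have bc := wf_bounded wc; case: (bc) => Bi Bw Ba.
case E: (fs c) => [[c' l]|]; first by have [_ <-] := fs_Some wc E; exists l.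
move: E; rewrite /fs /fwd /step vc.
rewrite /flags_of is_left_end_isym is_right_end_isym // /isym /wsym /abit.
case: trans => [[q' [a b]] [[mi mw] ma]] /=; case: ifP => // + _.
rewrite /legal /= is_left_end_isym is_right_end_isym // can_move_eff /=
  -!dshift_eff.
have aux m p hi : p < hi ->
    ~~ can_move (eff_dir m (p == 0) false) (p == 0) (p.+1 == hi) ->
    dshift (eff_dir m (p == 0) false) p < hi -> False.
  by case: m => //= _; [case: eqP => //|move=> /negPn/eqP ->; rewrite ltnn].
by move=> /negbT; rewrite negb_and => /orP [] nm lw la;
  [case: (aux _ _ _ Bw nm lw)|case: (aux _ _ _ Ba nm la)].
Qed.

Definition code c :=
  (cstate c, inord (input_pos c) : 'I_n.+2,
   inord (work_pos c) : 'I_T.+1, [ffun i : 'I_T => work_tape c i],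
   inord (aux_pos c) : 'I_(2 ^ T).+1, [ffun i : 'I_(2 ^ T) => aux_tape c i]).

Lemma code_inj c c' : wf c -> wf c' -> code c = code c' -> c = c'.
Proof.
case: c c' => [q i p w a t] [q' i' p' w' a' t'].
case=> /= Bi Bp Ba Hw Ht [/= Bi' Bp' Ba' Hw' Ht'] [<-].
move=> /(congr1 val) /=; rewrite !inordK ?ltnS // => <-.
move=> /(congr1 val) /=; rewrite !inordK ?ltnS // 1?ltnW // => <- /ffunP Ew.
move=> /(congr1 val) /=; rewrite !inordK ?ltnS // 1?ltnW // => <- /ffunP Et.
congr Config; apply: functional_extensionality => j.
  case: (ltnP j T) => lj; last by rewrite Hw // Hw'.
  by have := Ew (Ordinal lj); rewrite !ffunE.
case: (ltnP j (2 ^ T)) => lj; last by rewrite Ht // Ht'.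
by have := Et (Ordinal lj); rewrite !ffunE.
Qed.

End Graph.

(** * Initial configurations met by the tour *)

(** A word in the ball arises from [u] by flipping at most [k] positions, which a function from
    ['I_k] to optional positions can list. *)
Lemma hamming_ball m k (u : m.-tuple bool) :
  #|[set w | hamming u w <= k]| <= m.+1 ^ k.
Proof.
pose flip (f : {ffun 'I_k -> option 'I_m}) : m.-tuple bool :=
  [tuple tnth u i (+) [exists j, f j == Some i] | i < m].
have -> : m.+1 ^ k = #|{ffun 'I_k -> option 'I_m}|.
  by rewrite card_ffun card_option !card_ord.
apply: leq_trans (leq_image_card flip _); apply: subset_leq_card.
apply/subsetP => w; rewrite inE /hamming; set D := [set i | _] => leDk.
apply/imageP; exists [ffun j : 'I_k => nth None (map Some (enum D)) j] => //.
apply: eq_from_tnth => i; rewrite tnth_mktuple.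
have -> : [exists j : 'I_k, [ffun j0 : 'I_k => nth None (map Some
  (enum D)) j0] j == Some i] = (i \in D).
  apply/existsP/idP => [[j]|iD].
    rewrite ffunE; case: (ltnP j (size (map Some (enum D)))) => lj;
      last by rewrite nth_default.
    move/eqP=> E; have := mem_nth None lj; by rewrite E (mem_map Some_inj) mem_enum.
  have idx : index i (enum D) < #|D| by rewrite cardE index_mem mem_enum.
  exists (Ordinal (leq_trans idx leDk)); rewrite ffunE /= (nth_map i) -?cardE //.
  by rewrite nth_index // mem_enum.
by rewrite inE; case: (tnth u i) (tnth w i) => [] [].
Qed.

Lemma step_halted M x (c : config M) v : verdict (cstate c) = Some v -> step x c =
  c.
Proof. by rewrite /step => ->. Qed.

Lemma iter_step_halted M x (c : config M) v t :
  verdict (cstate c) = Some v -> iter t (step x) c = c.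
Proof. by move=> vc; elim: t => //= t ->; apply: step_halted vc. Qed.

Lemma halted_unique M x (c : config M) t t' v v' :
  verdict (cstate (iter t (step x) c)) = Some v ->
  verdict (cstate (iter t' (step x) c)) = Some v' ->
  iter t (step x) c = iter t' (step x) c.
Proof.
wlog le_tt' : t t' v v' / t <= t'.
  by move=> wl V V'; case/orP: (leq_total t t') => le; [apply: wl V V'|apply/esym;
    apply: wl V' V].
by move=> V _; rewrite -(subnK le_tt') iterD (iter_step_halted _ _ V).
Qed.

Section Trajectories.
Variables (k : nat) (M : machine) (s : nat -> nat) (x : seq bool) (T : nat).
Hypothesis LM : lossy_catalytic_TM k M s (fun n => 2 ^ s n).
Hypothesis le_sT : s (size x) <= T.
Notation sa := (2 ^ s (size x)).
Implicit Types (a : nat -> bool) (c h : config M).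

Definition start_cfg (a : nat -> bool) : config M :=
  Config (start M) 0 0 (fun=> blank M) 0 a.
Definition pre a : sa.-tuple bool := [tuple a i | i < sa].

(** The simulator's auxiliary tape is longer than the one promised to [M]; the surplus is never
    visited and stays as it was. *)
Lemma iter_step_start a t :
  let c := run M x (pre a) t in
  iter t (step x) (start_cfg a) =
  Config (cstate c) (input_pos c) (work_pos c) (work_tape c) (aux_pos c)
    (fun i => if i < sa then aux_tape c i else a i).
Proof.
elim: t => [|t IH].
  congr Config; apply: functional_extensionality => i; case: ltnP => // lti.
  by have := tnth_nth false (pre a) (Ordinal lti); rewrite tnth_mktuple.
rewrite iterS IH {IH} [run M x (pre a) t.+1]iterS -/(run M x (pre a) t).
have [SB _ _] := LM; have [_] := SB x (pre a) t.
set c := run M x (pre a) t => lt_p /=.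
rewrite /step /= lt_p; case: verdict => //.
case: trans => [[q [g b]] [[mi mw] ma]] /=; congr Config.
apply: functional_extensionality => i; rewrite /write.
by case: eqP => [->|]; rewrite ?lt_p.
Qed.

Lemma start_wf a : wf x T a (start_cfg a).
Proof.
have [SB _ _] := LM; have [lt_p _] := SB x (pre a) 0.
by split=> //=; rewrite ?expn_gt0 //; apply: leq_trans le_sT.
Qed.

Lemma iter_step_fwd_path a t : exists n,
  fwd_path (fs x T) n (start_cfg a) (iter t (step x) (start_cfg a)) /\
  wf x T a (iter t (step x) (start_cfg a)).
Proof.
elim: t => [|t [n [P wc]]]; first by exists 0; split=> //; apply: start_wf.
move: (iter_step_start a t.+1); rewrite iterS; set c := iter t _ _ in P wc *.
move=> E; case V: (verdict (cstate c)) => [v|].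
  by exists n; rewrite (step_halted _ V).
have [SB _ _] := LM; have [lt_w lt_a] := SB x (pre a) t.+1.
have [||l El] := step_fs wc V.
- by rewrite E; apply: leq_trans le_sT.
- by rewrite E; apply: leq_trans lt_a _; rewrite leq_exp2l.
exists (n + 1); split; last exact: fs_wf El.
by apply: fwd_path_trans P _; exists (step x c), l.
Qed.

(** As [a] is arbitrary, this applies to the given initial configuration and to every other one in
    its tree. *)
Lemma start_rooted a : exists h, rooted (fs x T) (start_cfg a) h /\
  [/\ exists t v, verdict (cstate h) = Some v /\
                  verdict (cstate (run M x (pre a) t)) = Some v,
      hamming (pre (aux_tape h)) (pre a) <= k
    & forall j, sa <= j -> aux_tape h j = a j].
Proof.
have [_ /(_ x (pre a)) [t [[v V] H]] _] := LM.
have [n [P _]] := iter_step_fwd_path a t; have E := iter_step_start a t.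
exists (iter t (step x) (start_cfg a)); split.
  by split; [apply: (@fs_verdict _ _ _ _ v); rewrite E|exists n].
split; first by exists t, v; rewrite E.
  have -> // : pre (aux_tape (iter t (step x) (start_cfg a))) =
            aux_content sa (run M x (pre a) t).
  by apply: eq_from_tnth => i; rewrite !tnth_mktuple E /= ltn_ord.
by move=> j le_j; rewrite E /= ltnNge le_j.
Qed.

Lemma rooted_unique c h h' :
  rooted (fs x T) c h -> rooted (fs x T) c h' -> h = h'.
Proof.
move=> [Eh [n P]] [Eh' [n' P']].
by have [] := fwd_path_length Eh Eh' P P'.
Qed.

Notation tourM := (tour (fs x T) (bs x T)).
Notation portM := (port (edge M)).

(** Fixing the port [ord0] makes a configuration count at only one of its ports. Blanks beyond [T]
    come from [wf]. *)
Definition is_start (y : config M * portM) : bool :=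
  [&& cstate y.1 == start M, y.2 == ord0, input_pos y.1 == 0,
      work_pos y.1 == 0, aux_pos y.1 == 0
    & all (fun i => work_tape y.1 i == blank M) (iota 0 T)].

Lemma is_startP a y : wf x T a y.1 -> is_start y ->
  y = (start_cfg (aux_tape y.1), ord0).
Proof.
case: y => [[q i p w b t] e] /= [_ _ _ Hw _].
case/and5P => /= /eqP -> /eqP -> /eqP -> /eqP -> /andP [/eqP ->].
move/allP => /= B; congr (Config _ _ _ _ _ _, _).
apply: functional_extensionality => j; case: (ltnP j T) => lj; last exact: Hw.
by apply/eqP/B; rewrite mem_iota.
Qed.

Lemma is_start_start a : is_start (start_cfg a, ord0).
Proof. by rewrite /is_start /= !eqxx /=; apply/allP. Qed.

(** [N] is the first time at a halting configuration, necessarily the root [h]. Until then no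
    position repeats, and the starts met have auxiliary tapes in one Hamming ball around that of
    [h]. *)
Theorem tour_search a : exists N v,
  let y i := iter i tourM (start_cfg a, ord0) in
  [/\ verdict (cstate (y N).1) = Some v,
      forall i, i < N -> verdict (cstate (y i).1) = None,
      count (fun i => is_start (y i)) (iota 0 N.+1) <= sa.+1 ^ k
    & exists t, verdict (cstate (run M x (pre a) t)) = Some v].
Proof.
have [h [R [[t [v [Vh Vt]]] _ _]]] := start_rooted a.
have wa := start_wf a.
pose y i := iter i tourM (start_cfg a, ord0).
have wy i : wf x T a (y i).1 by apply: iter_tour_wf => // *;
  [apply: fs_wf|apply: bs_wf]; eassumption.
have Ry i : rooted (fs x T) (y i).1 h.
  by apply: (iter_rooted_tour (wf := wf x T a)) => // *;
    [apply: fs_wf|apply: bs_wf|apply: bsK]; eassumption.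
have ex_halt : exists i, verdict (cstate (y i).1) != None.
  have [|||||||N EN] := @tour_root _ _ _ (wf x T a) (@code M x T) (fs x T)
    (bs x T) _ _ _ _ _ (start_cfg a) h => //.
  - exact: code_inj.
  - exact: fs_wf.
  - exact: bs_wf.
  - exact: fsK.
  - exact: bsK.
  by exists N; rewrite /y EN Vh.
pose N := ex_minn ex_halt; have [VN minN] : verdict (cstate (y N).1) != None /\
    forall i, i < N -> verdict (cstate (y i).1) = None.
  rewrite /N; case: ex_minnP => m Vm minm; split=> // i lt_im.
  by apply/eqP/negPn/negP => /minm; rewrite leqNgt lt_im.
exists N, v; split=> //; last by exists t.
- have [Eh [[|n] /= P]] := Ry N; first by rewrite -/(y N) P.
  by case: P => c' [l [/fs_Some-/(_ _ (wy N)) [E _]]]; rewrite E in VN.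
pose S := [seq i <- iota 0 N.+1 | is_start (y i)].
rewrite -size_filter -/S -(size_map (fun i => pre (aux_tape (y i).1))).
have yj i : i \in S -> y i = (start_cfg (aux_tape (y i).1), ord0).
  by rewrite mem_filter => /andP [+ _]; apply: is_startP.
have facts i : i \in S -> hamming (pre (aux_tape h)) (pre (aux_tape
  (y i).1)) <= k /\
    forall j, sa <= j -> aux_tape h j = aux_tape (y i).1 j.
  move=> iS; have [h' [R' [_ H J]]] := start_rooted (aux_tape (y i).1).
  suff -> : h = h' by [].
  by apply: rooted_unique (Ry i) _; rewrite (yj _ iS).
apply: leq_trans (hamming_ball k (pre (aux_tape h))).
rewrite cardE; apply: uniq_leq_size; last first.
  by move=> _ /mapP [i iS ->]; rewrite mem_enum inE; case: (facts i iS).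
(* Equal prefixes force equal positions of the tour, because beyond [sa] both tapes agree with that
   of [h]. *)
rewrite map_inj_in_uniq ?filter_uniq ?iota_uniq // => i j iS jS Eij.
have {}Eij : y i = y j.
  rewrite (yj _ iS) (yj _ jS); congr (start_cfg _, _).
  apply: functional_extensionality => m; case: (ltnP m sa) => lm.
    by have := congr1 (fun u => tnth u (Ordinal lm)) Eij; rewrite !tnth_mktuple.
  by have [_ Fi] := facts _ iS; have [_ Fj] := facts _ jS; rewrite -Fi // -Fj.
have leN l : l \in S -> l <= N by rewrite mem_filter mem_iota => /andP [].
wlog lt_ij : i j iS jS Eij / i < j.
  move=> wl; case: (ltngtP i j) => // lt_ij; first exact: wl.
  by apply/esym; apply: wl.
(* A repetition at [i < j <= N] would put the halting vertex already at time [N - (j - i)]. *)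
have lejN := leN _ jS; exfalso; have := minN (N - (j - i)).
rewrite ltn_subrL subn_gt0 lt_ij (leq_trans _ lejN) ?(leq_trans _ lt_ij) // => /(_
  isT) V.
suff E : y (N - (j - i)) = y N by rewrite E in V; rewrite V in VN.
have -> : N - (j - i) = (N - j) + i by rewrite subnBA ?(ltnW lt_ij) // addnBAC.
by rewrite -{2}(subnK lejN) /y !iterD -/(y i) -/(y j) Eij.
Qed.

End Trajectories.

(** * The simulating machine *)

(** [P] is kept at every intermediate configuration because the space bound concerns all times. *)
Inductive reach (M : machine) (x : seq bool) (P : config M -> Prop) :
    config M -> config M -> Prop :=
  | reach_refl c : P c -> reach x P c c
  | reach_step c c' : P c -> reach x P (step x c) c' -> reach x P c c'.

Lemma reach_trans M x P (c1 c2 c3 : config M) :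
  reach x P c1 c2 -> reach x P c2 c3 -> reach x P c1 c3.
Proof. by elim=> // c c' Pc _ IH R; apply: reach_step => //; apply: IH. Qed.

Lemma reach_iter M x P (c c' : config M) v :
  reach x P c c' -> verdict (cstate c') = Some v ->
  (exists t, iter t (step x) c = c') /\ forall t, P (iter t (step x) c).
Proof.
elim=> {c c'} [c Pc|c c' Pc _ IH] V.
  by split=> [|t]; [exists 0|rewrite (iter_step_halted _ _ V)].
have [[t Et] Pt] := IH V; split; first by exists t.+1; rewrite iterSr.
by case=> // t'; rewrite iterSr.
Qed.

(** * Counters updated digit by digit *)

Section Digits.
Variable b : nat.
Notation B := b.+1.

Definition dig (v i : nat) : 'I_B := Ordinal (ltn_pmod (v %/ B ^ i) (ltn0Sn b)).

Definition dop (o : dir) (d : 'I_B) : 'I_B :=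
  match o with None => d | Some true => ordS d | Some false => ord_pred d end.
Definition dcarry (o : dir) (d : 'I_B) : dir :=
  match o with
  | None => None
  | Some true => if d == ord_max then o else None
  | Some false => if d == ord0 then o else None
  end.

Lemma dvdn_dig0 v i : (B ^ i.+1 %| v) = (B ^ i %| v) && (dig v i == ord0).
Proof.
rewrite -val_eqE /= expnSr; case: (boolP (B ^ i %| v)) => [dv|ndv] /=.
  by rewrite -{1}(divnK dv) mulnC dvdn_pmul2r ?expn_gt0.
by apply/negbTE; apply: contraNN ndv; apply: dvdn_trans; apply: dvdn_mulr.
Qed.

Lemma digS u i : dig u.+1 i = if B ^ i %| u.+1 then ordS (dig u i) else dig u i.
Proof.
apply: val_inj; case: ifP => dv /=; rewrite divnS ?expn_gt0 // dv //=.
by rewrite add1n -[in RHS]addn1 modnDml addn1.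
Qed.

Lemma dvdn_dig_max u i :
  (B ^ i.+1 %| u.+1) = (B ^ i %| u.+1) && (dig u i == ord_max).
Proof.
rewrite dvdn_dig0 digS; case: (B ^ i %| u.+1) => //=.
move: (dig u i) => d; rewrite -!val_eqE /=.
have := ltn_ord d; rewrite ltnS; case: ltngtP => // [lt|->] _.
  by rewrite modn_small.
by rewrite modnn.
Qed.

(** A carry or borrow reaches digit [i] exactly when [B ^ i] divides the larger of the old and new
    values: the lower digits are all maximal before an increment, all zero before a decrement. *)
Definition carry (o : dir) v i : dir :=
  if B ^ i %| maxn v (dshift o v) then o else None.

Lemma carry0 o v : carry o v 0 = o.
Proof. by rewrite /carry expn0 dvd1n. Qed.

Lemma dop_carry o v i : (o = Some false -> 0 < v) ->
  dop (carry o v i) (dig v i) = dig (dshift o v) i.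
Proof.
case: o => [[]|] /=; rewrite /carry /=.
- rewrite (maxn_idPr (leqnSn v)) digS; by case: ifP.
- case: v => [/(_ erefl) //|u _] /=.
  by rewrite (maxn_idPl (leqnSn u)) digS; case: ifP => //= _; rewrite ordSK.
- by case: ifP.
Qed.

Lemma dcarry_carry o v i : (o = Some false -> 0 < v) ->
  dcarry (carry o v i) (dig v i) = carry o v i.+1.
Proof.
case: o => [[]|] /=; rewrite /carry /=.
- by rewrite (maxn_idPr (leqnSn v)) dvdn_dig_max; case: (B ^ i %| _).
- case: v => [/(_ erefl) //|u _] /=.
  by rewrite (maxn_idPl (leqnSn u)) dvdn_dig0; case: (B ^ i %| _).
- by case: ifP; case: ifP.
Qed.

End Digits.

Inductive tape_symbol (A : Type) : Type :=
  Blank | LMark | Count of option bool | Cell of A.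
Arguments Blank {A}.
Arguments LMark {A}.
Arguments Count {A}.

Section TapeSymbol.
Variable A : finType.
Definition tape_symbol_code (a : tape_symbol A) :
  option (option (option bool + A)) :=
  match a with
  | Blank => None | LMark => Some None
  | Count o => Some (Some (inl o)) | Cell a => Some (Some (inr a))
  end.
Definition tape_symbol_decode (a : option (option (option bool + A))) :
  tape_symbol A :=
  match a with
  | None => Blank | Some None => LMark
  | Some (Some (inl o)) => Count o | Some (Some (inr a)) => Cell a
  end.
Lemma tape_symbol_codeK : cancel tape_symbol_code tape_symbol_decode.
Proof. by case. Qed.
HB.instance Definition _ := Finite.copy (tape_symbol A)
  (can_type tape_symbol_codeK).
End TapeSymbol.

(* The program counter of the simulation: test for an initial configuration,
   test whether the counter of visits has dropped to 0, traverse the current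
   half-edge, complete or cancel the traversal of an edge against its
   orientation. *)
Inductive pc := PCheck | PZero | PSwap | PUndo.
Definition pc_code p : bool * bool :=
  match p with PCheck => (false, false) | PZero => (false, true)
             | PSwap => (true, false) | PUndo => (true, true) end.
Definition pc_decode (p : bool * bool) :=
  match p with (false, false) => PCheck | (false, true) => PZero
             | (true, false) => PSwap | (true, true) => PUndo end.
Lemma pc_codeK : cancel pc_code pc_decode.
Proof. by case. Qed.
HB.instance Definition _ := Finite.copy pc (can_type pc_codeK).

Section Simulator.
Variables (M : machine) (C b : nat).
Notation Q := (state M).
Notation G := (work_symbol M).
Notation portM := (port (edge M)).

(* The second component is [None] on the way to the halting configuration and
   [Some v] on the way back with verdict [v]. *)
Definition control := (pc * option bool * Q * portM)%type.

(* Contents of the simulated cell, presence of the simulated work head, a bit of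
   the position of the auxiliary head, a digit of the counter of visits. *)
Definition cell := (G * bool * 'I_2 * 'I_b.+1)%type.

(* Information collected by a sweep to the right: whether no cell has been seen,
   the scanned work symbol, the head flags, whether the simulated work tape is
   blank, whether the counter of visits is 0. *)
Definition summary := (bool * G * flags * bool * bool)%type.

(** The states up to [SConv] lay out the work tape. Then [SLeft] and [SRight] alternate: head mark,
    auxiliary position and visit counter are spread over the cells, so each round must pass through
    all of them. *)
Inductive sim_state :=
  | SInit | SInc | SBack | SRewind
  | SGrow of 'I_C.+1
  | SConv of bool
  | SLeft of control * G * dirs * bool
  | SRight of control * (bool * bool * dir * dir) * summary
  | SDone of bool.

Definition sim_code st : (bool * bool) + 'I_C.+1 + bool +
    (control * G * dirs * bool) +
    (control * (bool * bool * dir * dir) * summary) + bool :=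
  match st with
  | SInit => inl (inl (inl (inl (inl (false, false)))))
  | SInc => inl (inl (inl (inl (inl (false, true)))))
  | SBack => inl (inl (inl (inl (inl (true, false)))))
  | SRewind => inl (inl (inl (inl (inl (true, true)))))
  | SGrow j => inl (inl (inl (inl (inr j))))
  | SConv f => inl (inl (inl (inr f)))
  | SLeft l => inl (inl (inr l))
  | SRight r => inl (inr r)
  | SDone v => inr v
  end.
Definition sim_decode st :=
  match st with
  | inl (inl (inl (inl (inl (false, false))))) => SInit
  | inl (inl (inl (inl (inl (false, true))))) => SInc
  | inl (inl (inl (inl (inl (true, false))))) => SBack
  | inl (inl (inl (inl (inl (true, true))))) => SRewind
  | inl (inl (inl (inl (inr j)))) => SGrow j
  | inl (inl (inl (inr f))) => SConv f
  | inl (inl (inr l)) => SLeft l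
  | inl (inr r) => SRight r
  | inr v => SDone v
  end.
Lemma sim_codeK : cancel sim_code sim_decode.
Proof. by case. Qed.
HB.instance Definition _ := Finite.copy sim_state (can_type sim_codeK).

Definition command := (control * (G * bool * dirs) * dir)%type.

(* The traversal of a half-edge is followed by a rotation on the way forth and
   preceded by one on the way back. *)
Definition after_swap (mo : option bool) (q : Q) (e : portM)
    (gbd : G * bool * dirs) : command :=
  ((PCheck, mo, q, if mo is None then ordS e else e), gbd, None).

(** At a halting state the program stays at [PCheck] with the verdict stored, so a visit counted at
    the turning point is uncounted like any other. *)
Definition decide (ct : control) (i : input_symbol) (g : G) (a : bool)
    (fl : flags) (bl : bool) : command :=
  let: (p, mo, q, e) := ct in
  let: (w0, w1, a0, a1) := fl in
  match p with
  | PCheck =>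
      let ini := [&& q == start M, e == ord0, is_left_end i, w0, a0 & bl] in
      match mo with
      | None => ((if verdict q is Some _ then PCheck else PSwap, verdict q, q, e),
                 (g, a, stay), if ini then Some true else None)
      | Some _ => ((PZero, mo, q, e), (g, a, stay),
                   if ini then Some false else None)
      end
  | PZero => ((PSwap, mo, q, ord_pred e), (g, a, stay), None)
  | PSwap =>
      match label_of e with
      | None =>
          if fwd q i g a fl is Some r then
            after_swap mo r.1.1 (port_of ((q, (g, a), r.2) : edge M)) (r.1.2, r.2)
          else after_swap mo q e (g, a, stay)
      | Some l =>
          if legal i fl (opps l.2) then
            ((PUndo, mo, q, e), (g, a, opps l.2), None)
          else after_swap mo q e (g, a, stay)
      end
  | PUndo =>
      if label_of e is Some l then
        if undoes l q i g a fl then after_swap mo l.1.1 ord0 (l.1.2, stay)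
        else after_swap mo q e (g, a, l.2)
      else after_swap mo q e (g, a, stay)
  end.

Definition finished (ct : control) (rz : bool) : option bool :=
  if ct is (PZero, mo, _, _) then if rz then mo else None else None.

Definition summary0 : summary :=
  (true, blank M, (false, false, true, true), true, true).

Definition summarize (sm : summary) (ce : cell) : summary :=
  let: (first, g, (w0, w1, a0, a1), bl, rz) := sm in
  let: (g', h, d, u) := ce in
  (false, if h then g' else g,
   (if first then h else w0, h, a0 && (d == ord0), a1 && (d == ord_max)),
   bl && (g' == blank M), rz && (u == ord0)).

(* Moving the head mark to the left requires a sweep to the left. *)
Definition left_cell (g : G) (dw : dir) (cm : bool) (ce : cell) : bool * cell :=
  let: (g0, h, d, u) := ce in
  ((dw == Some false) && h,
   (if h then g else g0, if dw == Some false then cm else h, d, u)).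

(** Digits are stored least significant first, so carries travel with the sweep to the right, as
    does a head mark moving right. *)
Definition right_cell (ops : bool * bool * dir * dir) (ce : cell) :
    (bool * bool * dir * dir) * cell :=
  let: (mr, cm, oa, ov) := ops in
  let: (g, h, d, u) := ce in
  ((mr, mr && h, dcarry oa d, dcarry ov u),
   (g, if mr then cm else h, dop oa d, dop ov u)).

Definition control0 : control := (PCheck, None, start M, ord0).

Definition sim_trans (st : sim_state) (i : input_symbol)
    (sy : tape_symbol cell) (a : bool) :
    sim_state * (tape_symbol cell * bool) * (move * move * move) :=
  match st with
  | SInit => (SInc, (LMark, a), (Stay, MoveR, Stay))
  | SInc =>
      match sy with
      | Count (Some false) => (SBack, (Count (Some true), a), (Stay, MoveL, Stay))
      | Count (Some true) => (SInc, (Count (Some false), a), (Stay, MoveR, Stay))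
      | Blank => (SGrow ord0, (Count (Some true), a), (Stay, MoveR, Stay))
      | _ => (SInc, (sy, a), (Stay, MoveR, Stay))
      end
  | SGrow j =>
      if j == ord_max then (SBack, (sy, a), (Stay, MoveL, Stay))
      else (SGrow (ordS j), (Count None, a), (Stay, MoveR, Stay))
  | SBack =>
      if sy is LMark then
        if is_right_end i then (SRewind, (sy, a), (Stay, Stay, Stay))
        else (SInc, (sy, a), (MoveR, MoveR, Stay))
      else (SBack, (sy, a), (Stay, MoveL, Stay))
  | SRewind =>
      if is_left_end i then (SConv true, (sy, a), (Stay, MoveR, Stay))
      else (SRewind, (sy, a), (MoveL, Stay, Stay))
  | SConv f =>
      if sy is Count _ then
        (SConv false, (Cell (blank M, f, ord0, ord0), a), (Stay, MoveR, Stay))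
      else (SLeft (control0, blank M, (None, None, None), false), (sy, a),
            (Stay, MoveL, Stay))
  | SLeft (ct, g, ds, cm) =>
      if sy is Cell ce then
        let: (cm', ce') := left_cell g ds.1.1 cm ce in
        (SLeft (ct, g, ds, cm'), (Cell ce', a), (Stay, MoveL, Stay))
      else
        (SRight (ct, (ds.1.1 == Some true, false, ds.1.2, ds.2), summary0),
         (sy, a), (Stay, MoveR, Stay))
  | SRight (ct, ops, sm) =>
      if sy is Cell ce then
        let: (ops', ce') := right_cell ops ce in
        (SRight (ct, ops', summarize sm ce'), (Cell ce', a), (Stay, MoveR, Stay))
      else
        let: (_, g, fl, bl, rz) := sm in
        if finished ct rz is Some v then
          (SDone v, (sy, a), (Stay, Stay, Stay))
        else
          let: (ct', (g', a', ds), ov) := decide ct i g a fl bl in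
          (SLeft (ct', g', (ds.1.2, ds.2, ov), false), (sy, a'),
           (dmove ds.1.1, MoveL, dmove ds.2))
  | SDone _ => (st, (sy, a), (Stay, Stay, Stay))
  end.

Definition simulator : machine :=
  @Machine sim_state (tape_symbol cell) Blank SInit
    (fun st => if st is SDone v then Some v else None) sim_trans.

End Simulator.

Arguments finished : simpl never.
Arguments decide : simpl never.

(** * Sweeps of the work tape *)

Lemma step_trans (M : machine) x (q q' : state M) ip wp wt ap at_ a a' mi mw ma :
  verdict q = None ->
  trans q (read_input x ip) (wt wp) (at_ ap) = (q', (a, a'), (mi, mw, ma)) ->
  step x (Config q ip wp wt ap at_) =
  Config q' (minn (shift mi ip) (size x).+1) (shift mw wp) (write wt wp a)
    (shift ma ap) (write at_ ap a').
Proof. by rewrite /step /= => -> ->. Qed.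

Section Sweeps.
Variables (M : machine) (C b : nat) (x : seq bool) (T : nat).
Notation S := (simulator M C b).
Notation n := (size x).
Implicit Types (f : nat -> cell M b) (c : config M).

(** Besides the [T] cells, the work tape uses the left mark and the first blank to their right. *)
Definition in_space (tm : config S) : Prop :=
  work_pos tm < T.+2 /\ aux_pos tm < 2 ^ T.+2.
Notation reachS := (reach x in_space).

Definition layout f : nat -> tape_symbol (cell M b) :=
  fun j => if j is i.+1 then if i < T then Cell (f i) else Blank else LMark.

Lemma eq_layout f f' : (forall i, i < T -> f i = f' i) -> layout f = layout f'.
Proof.
move=> E; apply: functional_extensionality => -[|i] //=.
by case: ltnP => // /E ->.
Qed.

Lemma write_layout f i ce : i < T ->
  write (layout f) i.+1 (Cell ce) = layout (write f i ce).
Proof.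
move=> lti; apply: functional_extensionality => -[|j] //=.
by rewrite /write /= eqSS; case: eqP => [->|_]; rewrite ?lti.
Qed.

Section OneSweep.
Variables (st : nat -> sim_state M C) (old new : nat -> cell M b).
Variables (ip ap : nat) (aux : nat -> bool).
Hypothesis ip_le : ip <= n.+1.
Hypothesis ap_lt : ap < 2 ^ T.+2.

Lemma sweep_left m : m <= T ->
  (forall i, i < T -> verdict (st i.+1 : state S) = None /\
     sim_trans (st i.+1) (read_input x ip) (Cell (old i)) (aux ap) =
     (st i, (Cell (new i), aux ap), (Stay, MoveL, Stay))) ->
  reachS (@Config S (st m) ip m (layout (fun i => if i < m then old i else new i))
    ap aux)
         (@Config S (st 0) ip 0 (layout new) ap aux).
Proof.
move=> + H; elim: m => [|m IH] ltm; first by apply: reach_refl; split.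
have [V E] := H _ ltm; apply: reach_step; first by split=> //=; apply: leqW.
have R : layout (fun i => if i < m.+1 then old i else new i) m.+1 = Cell (old m).
  by rewrite /= ltm ltnSn.
rewrite -R in E; rewrite (step_trans V E).
rewrite /= (minn_idPl ip_le) write_id write_layout //.
rewrite (_ : layout _ = layout (fun i => if i < m then old i else new i));
  first exact: IH (ltnW ltm).
apply: eq_layout => i _; rewrite /write; case: eqP => [->|/eqP ne];
  first by rewrite ltnn.
by rewrite ltnS leq_eqVlt (negbTE ne).
Qed.

Lemma sweep_right m : m <= T ->
  (forall i, i < T -> verdict (st i : state S) = None /\
     sim_trans (st i) (read_input x ip) (Cell (old i)) (aux ap) =
     (st i.+1, (Cell (new i), aux ap), (Stay, MoveR, Stay))) ->
  reachS (@Config S (st 0) ip 1 (layout old) ap aux)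
         (@Config S (st m) ip m.+1 (layout (fun i => if i < m then new i else old
           i)) ap aux).
Proof.
move=> + H; elim: m => [|m IH] ltm; first by apply: reach_refl; split.
apply: reach_trans (IH (ltnW ltm)) _.
have [V E] := H _ ltm; apply: reach_step; first by split=> //=; apply: leqW.
have R : layout (fun i => if i < m then new i else old i) m.+1 = Cell (old m).
  by rewrite /= ltm ltnn.
rewrite -R in E; rewrite (step_trans V E).
rewrite /= (minn_idPl ip_le) write_id write_layout //.
rewrite (_ : layout _ = layout (fun i => if i < m.+1 then new i else old i));
  first by apply: reach_refl; split.
apply: eq_layout => i _; rewrite /write; case: eqP => [->|/eqP ne];
  first by rewrite ltnSn.
by rewrite [in RHS]ltnS [in RHS]leq_eqVlt (negbTE ne).
Qed.

End OneSweep.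

Definition cells (wt : nat -> work_symbol M) (wp ap r i : nat) : cell M b :=
  (wt i, i == wp, dig 1 ap i, dig b r i).

Definition blank_upto (wt : nat -> work_symbol M) i :=
  all (fun j => wt j == blank M) (iota 0 i).

(** The lowest [i] bits of [ap] are all 0 iff [2 ^ i] divides [ap], and all 1 iff it divides
    [ap.+1]; this gives the partial information of a sweep in closed form. *)
Definition summary_of wt wp ap r i : summary M :=
  (i == 0, if wp < i then wt wp else blank M,
   ((0 < i) && (wp == 0), wp.+1 == i, 2 ^ i %| ap, 2 ^ i %| ap.+1),
   blank_upto wt i, b.+1 ^ i %| r).

Lemma summarize_cells wt wp ap r i :
  summarize (summary_of wt wp ap r i) (cells wt wp ap r i) =
  summary_of wt wp ap r i.+1.
Proof.
rewrite /summarize /cells /summary_of (dvdn_dig0 1 ap) (dvdn_dig0 b r)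
  (dvdn_dig_max 1 ap).
have -> : blank_upto wt i.+1 = blank_upto wt i && (wt i == blank M).
  by rewrite /blank_upto -[in LHS]addn1 iotaD all_cat /= andbT.
congr (_, _, (_, _, _, _), _, _).
- by rewrite [in RHS]ltnS [in RHS]leq_eqVlt [in RHS]eq_sym; case: eqP => [->|].
- by case: i => [|i] //=; rewrite eq_sym.
- by rewrite eqSS eq_sym.
Qed.

Lemma sweep ct g ds wt wp ap r ip aux :
  let ap' := dshift ds.1.2 ap in let r' := dshift ds.2 r in
  let wp' := dshift ds.1.1 wp in let wt' := write wt wp g in
  ip <= n.+1 -> wp < T -> can_move ds.1.1 (wp == 0) (wp.+1 == T) ->
  (ds.1.2 = Some false -> 0 < ap) -> (ds.2 = Some false -> 0 < r) ->
  ap' < 2 ^ T.+2 ->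
  exists ops,
  reachS (@Config S (SLeft C (ct, g, ds, false)) ip T (layout
    (cells wt wp ap r)) ap' aux)
         (@Config S (SRight C (ct, ops, summary_of wt' wp' ap' r' T)) ip T.+1
            (layout (cells wt' wp' ap' r')) ap' aux).
Proof.
case: ds => [[dw da] dr] /= ip_le wp_lt cmw pos_a pos_r ap_lt.
set ap' := dshift da ap in ap_lt *; set wt' := write _ _ _.
set r' := dshift dr r; set wp' := dshift dw wp.
(* Position of the head mark between the two sweeps: a left move is done, a right move still
   pending. *)
pose wpL := if dw == Some false then wp.-1 else wp.
pose mid := cells wt' wpL ap r.
pose stL i := SLeft C (ct, g, (dw, da, dr), (dw == Some false) && (wp == i)) :
  sim_state M C.
pose ops i := (dw == Some true, (dw == Some true) && (wp.+1 == i),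
               carry 1 da ap i, carry b dr r i).
pose stR i := SRight C (ct, ops i, summary_of wt' wp' ap' r' i) : sim_state M C.
exists (ops T).
have -> : SLeft C (ct, g, (dw, da, dr), false) = stL T.
  by rewrite /stL (ltn_eqF wp_lt) andbF.
rewrite (_ : layout (cells wt wp ap r) = layout
  (fun i => if i < T then cells wt wp ap r i else mid i)); last first.
  by apply: eq_layout => i ->.
apply: reach_trans (sweep_left ip_le ap_lt (leqnn T) _) _.
  move=> i ltT; split=> //=; rewrite /stL /mid /cells /wt' /write /wpL.
  rewrite [wp == i]eq_sym; congr (_, (Cell (_, _, _, _), _), _).
  case: eqP => // Ed; rewrite Ed /= in cmw *.
  by case: (wp) cmw => // p _; rewrite eqSS eq_sym.
apply: reach_step; first by split.
rewrite (@step_trans S _ (stL 0) (stR 0) ip 0 _ ap' aux LMark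
  (aux ap') Stay MoveR Stay) //; last first.
  rewrite /= /stR /ops !carry0 /summary_of /=; rewrite !dvd1n ?andbF;
    case: (dw == Some true) => //.
rewrite /= (minn_idPl ip_le) !write_id.
rewrite [X in reach _ _ _ X](_ : _ = @Config S (stR T) ip T.+1 (layout
  (fun i => if i < T then cells wt' wp' ap' r' i else mid i)) ap' aux); last first.
  by congr Config; apply: eq_layout => i ->.
apply: (sweep_right ip_le ap_lt (leqnn T)) => i ltT; split=> //.
have Ec : (if dw == Some true then (dw == Some true) &&
  (wp.+1 == i) else i == wpL) = (i == wp').
  rewrite /wpL /wp'; case: (dw) cmw => [[]|] //= _; by rewrite eq_sym.
have Em : (dw == Some true) && (i == wpL) = (dw == Some true) && (wp.+1 == i.+1).
  by rewrite /wpL; case: (dw) => [[]|] //=; rewrite eqSS eq_sym.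
have Er : right_cell (ops i) (mid i) = (ops i.+1, cells wt' wp' ap' r' i).
  by rewrite /right_cell /= Ec Em !dop_carry // !dcarry_carry.
by rewrite /sim_trans /stR Er summarize_cells.
Qed.

End Sweeps.

(** * Walking along the tour *)

Lemma dvdn_small d m : m < d -> (d %| m) = (m == 0).
Proof. by case: m => [|m] ltm; [rewrite dvdn0|rewrite gtnNdvd]. Qed.

Section Walk.
Variables (M : machine) (C b : nat) (x : seq bool) (T : nat).
Hypothesis T_gt0 : 0 < T.
Notation S := (simulator M C b).
Notation reachS := (reach x (@in_space M C b T)).
Notation portM := (port (edge M)).
Implicit Types (c : config M) (e : portM) (p : pc) (mo : option bool) (r : nat).

(* The simulator has just finished a sweep to the right; [ops] is irrelevant. *)
Definition checkpoint ops p mo e c r : config S :=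
  @Config S (SRight C ((p, mo, cstate c, e), ops,
      summary_of b (work_tape c) (work_pos c) (aux_pos c) r T))
    (input_pos c) T.+1
    (layout T (cells b (work_tape c) (work_pos c) (aux_pos c) r))
    (aux_pos c) (aux_tape c).

Lemma summary_ofT c r : bounded x T c -> r < b.+1 ^ T ->
  summary_of b (work_tape c) (work_pos c) (aux_pos c) r T =
  (false, wsym c, flags_of T c, blank_upto (work_tape c) T, r == 0).
Proof.
case=> _ lw la lr; rewrite /summary_of /flags_of T_gt0 lw -(dvdn_small lr).
congr (_, _, (_, _, _, _), _, _).
- by rewrite eqn0Ngt T_gt0.
- exact: dvdn_small.
- move: la; rewrite leq_eqVlt => /orP [/eqP ->|lt]; first by rewrite dvdnn eqxx.
  by rewrite (dvdn_small lt) (ltn_eqF lt).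
Qed.

Lemma bounded_aux_lt c : bounded x T c -> aux_pos c < 2 ^ T.+2.
Proof. by case=> _ _ la; apply: leq_trans la _;
  rewrite leq_exp2l // -addn2 leq_addr. Qed.

Lemma shift_dmove d i : shift (dmove d) i = dshift d i.
Proof. by case: d => [[]|]. Qed.

(** The unit of simulation: one decision, then a sweep in each direction. *)
Lemma macro_step ops p mo e c r p' mo' q' e' g a ds ov :
  bounded x T c -> r < b.+1 ^ T ->
  finished (p, mo, cstate c, e) (r == 0) = None ->
  decide (p, mo, cstate c, e) (isym x c) (wsym c) (abit c) (flags_of T c)
    (blank_upto (work_tape c) T) = ((p', mo', q', e'), (g, a, ds), ov) ->
  legal (isym x c) (flags_of T c) ds -> (ov = Some false -> 0 < r) ->
  exists ops', reachS (checkpoint ops p mo e c r)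
    (checkpoint ops' p' mo' e' (act (q', (g, a), ds) c) (dshift ov r)).
Proof.
move=> bc lr fin dec lg pos_r.
have bc' := @act_bounded _ _ _ (q', (g, a), ds) _ bc lg.
have [Li Lw La] := legalP bc lg; case: (bc) => Bi Bw Ba.
have [||||||ops' R] := @sweep M C b x T (p', mo', q', e') g (ds.1.2, ds.2, ov)
  (work_tape c) (work_pos c) (aux_pos c) r (dshift ds.1.1 (input_pos c))
  (write (aux_tape c) (aux_pos c) a) => //=.
- by case: bc'.
- by move=> Ed; move: La; rewrite Ed /= lt0n.
- exact: bounded_aux_lt bc'.
exists ops'; apply: reach_step; first by split=> //=; apply: bounded_aux_lt.
rewrite {1}/checkpoint summary_ofT //.
rewrite (@step_trans S _ _ (SLeft C ((p', mo', q', e'), g,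
  (ds.1.2, ds.2, ov), false))
  (input_pos c) T.+1 _ _ _ Blank a (dmove ds.1.1) MoveL (dmove ds.2)) //;
    last first.
  rewrite /= ltnn fin.
  by rewrite -/(isym x c) -/(abit c) dec.
rewrite !shift_dmove (minn_idPl _); last by case: bc'.
rewrite (_ : write _ _ Blank = layout T (cells b (work_tape c) (work_pos c)
  (aux_pos c) r)) //.
apply: functional_extensionality => j; rewrite /write; case: eqP => // ->.
by rewrite /= ltnn.
Qed.

Variable bey : nat -> bool.
Notation swapM := (swap (fs x T) (bs x T)).
Notation tourM := (tour (fs x T) (bs x T)).
Notation untourM := (untour (fs x T) (bs x T)).
Notation wfM := (wf x T bey).

Lemma legal_stay i fl : legal i fl stay.
Proof. by case: fl => [[[w0 w1] a0] a1]. Qed.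

(** Upwards one round suffices. Downwards the first round moves the heads back, and the second
    installs the predecessor or, if the label does not fit, moves the heads forth again. *)
Lemma swap_sim ops mo e c r : wfM c -> r < b.+1 ^ T ->
  let y := swapM (c, e) in
  exists ops', reachS (checkpoint ops PSwap mo e c r)
    (checkpoint ops' PCheck mo (if mo is None then ordS y.2 else y.2) y.1 r).
Proof.
move=> wc lr /=; have bc := wf_bounded wc; rewrite /swap /=.
case El: (label_of e) => [l|]; last first.
  rewrite /fs; case Ef: fwd => [[[q' [g a]] ds]|].
    have lg := fwd_legal Ef.
    apply: (macro_step ops (ov := None) bc lr _ _ lg) => //.
    by rewrite /decide El; case: flags_of Ef => [[[w0 w1] a0] a1] ->.
  rewrite /= -{2}[c]act_stay_id.
  apply: (macro_step ops (ov := None) bc lr _ _ (legal_stay _ _)) => //.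
  by rewrite /decide El; case: flags_of Ef => [[[w0 w1] a0] a1] ->.
rewrite /bs; case: ifP => lg; last first.
  rewrite /= -{2}[c]act_stay_id.
  apply: (macro_step ops (ov := None) bc lr _ _ (legal_stay _ _)) => //.
  by rewrite /decide El; case: flags_of lg => [[[w0 w1] a0] a1] ->.
have [|||ops1 R1] := macro_step ops (p := PSwap) (mo := mo) (e := e) (p' :=
  PUndo) (mo' := mo)
   (q' := cstate c) (g := wsym c) (a := abit c) (e' := e) (ov :=
     None) bc lr _ _ lg => //.
  by rewrite /decide El; case: flags_of lg => [[[w0 w1] a0] a1] ->.
have bc1 := @act_bounded _ _ _ (cstate c, (wsym c, abit c), opps l.2) _ bc lg.
rewrite -/(shift_back c l.2) in R1 bc1.
case: ifP => un.
  have [|||ops2 R2] := macro_step ops1 (p := PUndo) (mo := mo) (e := e) (p' :=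
    PCheck) (mo' := mo)
    (q' := l.1.1) (g := l.1.2.1) (a := l.1.2.2)
    (e' := if mo is None then ordS ord0 else ord0) (ov :=
      None) bc1 lr _ _ (legal_stay _ _) => //.
    rewrite /decide El; case: flags_of un => [[[w0 w1] a0] a1] ->.
    by rewrite /after_swap -surjective_pairing.
  exists ops2; apply: reach_trans R1 _; move: R2.
  by rewrite -!surjective_pairing.
have lg1 : legal (isym x (shift_back c l.2)) (flags_of T (shift_back c l.2)) l.2.
  rewrite -[X in legal _ _ X]oppsK.
  exact: (@legal_act _ _ _ (cstate c, (wsym c, abit c), opps l.2) _ bc lg).
have [|||ops2 R2] := macro_step ops1 (p := PUndo) (mo := mo) (e := e) (p' :=
  PCheck) (mo' := mo)
    (q' := cstate (shift_back c l.2)) (g := wsym (shift_back c l.2)) (a :=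
      abit (shift_back c l.2)) (e' := if mo is None then ordS e else e) (ov :=
      None) bc1 lr _ _ lg1 => //.
  by rewrite /decide El; case: flags_of un => [[[w0 w1] a0] a1] ->.
exists ops2; apply: reach_trans R1 _; move: R2.
by rewrite (shift_backK bc lg).
Qed.

Lemma check_ini c e :
  is_start T (c, e) = [&& cstate c == start M, e == ord0,
    is_left_end (isym x c), work_pos c == 0, aux_pos c == 0
    & blank_upto (work_tape c) T].
Proof. by rewrite is_left_end_isym. Qed.

Lemma forward_sim ops e c r : wfM c -> r < b.+1 ^ T ->
  r + is_start T (c, e) < b.+1 ^ T -> verdict (cstate c) = None ->
  exists ops', reachS (checkpoint ops PCheck None e c r)
    (checkpoint ops' PCheck None (tourM (c, e)).2 (tourM (c, e)).1
       (r + is_start T (c, e))).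
Proof.
move=> wc lr lr' V; have bc := wf_bounded wc.
have [|||ops1 R1] := macro_step ops (p := PCheck) (mo := None) (e := e)
  (p' := PSwap) (mo' := None) (q' := cstate c) (g := wsym c) (a := abit c) (e' := e)
  (ov := if is_start T (c, e) then Some true else None) bc lr _ _
    (legal_stay _ _) => //.
- by rewrite /decide /flags_of V check_ini.
- by case: ifP.
have [ops2 R2] := swap_sim ops1 None e wc lr'; exists ops2.
apply: reach_trans R1 _; rewrite act_stay_id.
suff -> : dshift (if is_start T (c, e) then Some true else None) r =
  r + is_start T (c, e) by [].
by case: is_start; rewrite ?addn1 ?addn0.
Qed.

Lemma turn_sim ops e c r v : wfM c -> r < b.+1 ^ T ->
  verdict (cstate c) = Some v ->
  exists ops', reachS (checkpoint ops PCheck None e c r)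
    (checkpoint ops' PCheck (Some v) e c (r + is_start T (c, e))).
Proof.
move=> wc lr V; have bc := wf_bounded wc.
have [|||ops1 R1] := macro_step ops (p := PCheck) (mo := None) (e := e)
  (p' := PCheck) (mo' := Some v) (q' := cstate c) (g := wsym c) (a :=
    abit c) (e' := e)
  (ov := if is_start T (c, e) then Some true else None) bc lr _ _
    (legal_stay _ _) => //.
- by rewrite /decide /flags_of V check_ini.
- by case: ifP.
exists ops1; move: R1; rewrite act_stay_id.
suff -> : dshift (if is_start T (c, e) then Some true else None) r =
  r + is_start T (c, e) by [].
by case: is_start; rewrite ?addn1 ?addn0.
Qed.

Lemma zero_sim ops e c r v : wfM c -> r + is_start T (c, e) < b.+1 ^ T ->
  exists ops', reachS (checkpoint ops PCheck (Some v) e c (r + is_start T (c, e)))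
    (checkpoint ops' PZero (Some v) e c r).
Proof.
move=> wc lr; have bc := wf_bounded wc.
have [|||ops1 R1] := macro_step ops (p := PCheck) (mo := Some v) (e := e)
  (p' := PZero) (mo' := Some v) (q' := cstate c) (g := wsym c) (a := abit c) (e' :=
    e)
  (ov := if is_start T (c, e) then Some false else None) bc lr _ _
    (legal_stay _ _) => //.
- by rewrite /decide /flags_of check_ini.
- by case: is_start => //; rewrite addn1.
exists ops1; move: R1; rewrite act_stay_id.
suff -> : dshift (if is_start T (c, e) then Some false else None) (r + is_start T
  (c, e)) = r by [].
by case: is_start; rewrite ?addn1 ?addn0.
Qed.

Lemma backward_sim ops e c r v : wfM c -> r < b.+1 ^ T -> 0 < r ->
  exists ops', reachS (checkpoint ops PZero (Some v) e c r)
    (checkpoint ops' PCheck (Some v) (untourM (c, e)).2 (untourM (c, e)).1 r).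
Proof.
move=> wc lr r_gt0; have bc := wf_bounded wc.
have [|||ops1 R1] := macro_step ops (p := PZero) (mo := Some v) (e := e)
  (p' := PSwap) (mo' := Some v) (q' := cstate c) (g := wsym c) (a := abit c) (e' :=
    ord_pred e)
  (ov := None) bc lr _ _ (legal_stay _ _) => //.
  by rewrite /finished eqn0Ngt r_gt0.
have [ops2 R2] := swap_sim ops1 (Some v) (ord_pred e) wc lr; exists ops2.
by apply: reach_trans R1 _; rewrite act_stay_id.
Qed.

Lemma done_sim ops e c v : wfM c ->
  exists tm, [/\ reachS (checkpoint ops PZero (Some v) e c 0) tm,
    verdict (cstate tm) = Some v & aux_tape tm = aux_tape c].
Proof.
move=> wc; have bc := wf_bounded wc; have la := bounded_aux_lt bc.
eexists; split; first (apply: reach_step; first by split).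
- rewrite /checkpoint summary_ofT ?expn_gt0 //.
  rewrite (@step_trans S _ _ (SDone M C v) (input_pos c) T.+1 _ _ _ Blank
    (abit c) Stay Stay Stay) //.
    by apply: reach_refl; split.
  by rewrite /= ltnn.
- by [].
- exact: write_id.
Qed.

(** At [y i] the counter holds [cnt i], the number of starts before time [i], on the way forth, and
    returns to it on the way back. As [y 0] is a start, [cnt i] vanishes only for [i = 0], so the
    zero test singles it out among starts that look alike. *)
Theorem walk_sim ops e0 c0 N v : wfM c0 -> is_start T (c0, e0) ->
  let y i := iter i tourM (c0, e0) in
  verdict (cstate (y N).1) = Some v ->
  (forall i, i < N -> verdict (cstate (y i).1) = None) ->
  count (fun i => is_start T (y i)) (iota 0 N.+1) < b.+1 ^ T ->
  exists tm, [/\ reachS (checkpoint ops PCheck None e0 c0 0) tm,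
    verdict (cstate tm) = Some v & aux_tape tm = aux_tape c0].
Proof.
move=> w0 s0 y VN Vi; pose cnt i := count (fun i => is_start T (y i)) (iota 0 i).
rewrite -/(cnt N.+1) => cntN.
have cntS i : cnt i.+1 = cnt i + is_start T (y i).
  by rewrite /cnt -addn1 iotaD count_cat /= addn0.
have wy i : wfM (y i).1.
  by apply: iter_tour_wf => // *; [apply: fs_wf|apply: bs_wf]; eassumption.
have cnt_le i j : i <= j -> cnt i <= cnt j.
  by move=> leij; rewrite -(subnK leij); elim: (j - i) => //= d IH;
    rewrite addSn cntS (leq_trans IH) ?leq_addr.
have lt_cnt i : i <= N.+1 -> cnt i < b.+1 ^ T.
  by move=> le_i; apply: leq_trans cntN; rewrite ltnS cnt_le.
have [ops1 R1] : exists ops1, reachS (checkpoint ops PCheck None e0 c0 0)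
    (checkpoint ops1 PCheck None (y N).2 (y N).1 (cnt N)).
  have: N <= N by []; elim: {1 3 4 5}N => [|i IH] ltN.
    exists ops; apply: reach_refl; split=> //=.
    exact: bounded_aux_lt (wf_bounded w0).
  have [ops1 R1] := IH (ltnW ltN); have ey : ((y i).1, (y i).2) =
    y i by case: (y i).
  have lr := lt_cnt i (leqW (ltnW ltN)); have lr' := lt_cnt i.+1 (leqW ltN).
  have := forward_sim ops1 (e := (y i).2) (wy i) lr.
  rewrite ey -cntS => /(_ lr' (Vi _ ltN)) [ops2 R2].
  by exists ops2; apply: reach_trans R1 R2.
have ey i : ((y i).1, (y i).2) = y i by case: (y i).
have [|ops2 R2] := turn_sim ops1 (y N).2 (wy N) (lt_cnt N _) VN;
  first exact: leqnSn.
rewrite ey -cntS in R2.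
suff back i : i <= N -> forall ops, exists tm,
    [/\ reachS (checkpoint ops PCheck (Some v) (y i).2 (y i).1 (cnt i.+1)) tm,
        verdict (cstate tm) = Some v & aux_tape tm = aux_tape c0].
  have [tm [R3 Vt At]] := back N (leqnn N) ops2; exists tm; split=> //.
  by apply: reach_trans R1 _; apply: reach_trans R2 R3.
elim: i => [|i IH] leN ops3.
  have := zero_sim ops3 (e := (y 0).2) (r := cnt 0) v (wy 0).
  rewrite ey -cntS => /(_ (lt_cnt _ _)) [//|ops4 R4].
  have [tm [R5 V A]] := done_sim ops4 (y 0).2 v (wy 0); exists tm; split=> //.
  exact: reach_trans R4 R5.
have := zero_sim ops3 (e := (y i.+1).2) (r := cnt i.+1) v (wy i.+1).
rewrite ey -cntS => /(_ (lt_cnt _ _)) [//|ops4 R4].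
have [||ops5] := backward_sim ops4 (y i.+1).2 v (wy i.+1) (lt_cnt i.+1 _).
- exact: leqW.
(* [cnt 1 = 1] because [y 0] is a start, so the walk does not stop at time [i.+1]. *)
- apply: leq_trans (cnt_le 1 _ _) => //; by rewrite /cnt /= s0.
rewrite ey [y i.+1]iterS (tourK (wf := wfM)); last exact: wy.
- move=> R5; have [tm [R6 V A]] := IH (ltnW leN) ops5; exists tm; split=> //.
  by apply: reach_trans R4 _; apply: reach_trans R5 R6.
- by move=> *; apply: fsK; eassumption.
- by move=> *; apply: bsK; eassumption.
Qed.

End Walk.

(** * Laying out the work tape *)

(* Binary numerals, least significant bit first. *)
Fixpoint binc (bs : seq bool) : seq bool :=
  match bs with
  | [::] => [:: true]
  | true :: bs' => false :: binc bs'
  | false :: bs' => true :: bs'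
  end.

Definition bval (bs : seq bool) : nat := foldr (fun (d : bool) v => d + v.*2) 0 bs.
Definition bits (v : nat) : seq bool := iter v binc [::].

Lemma bval_binc bs : bval (binc bs) = (bval bs).+1.
Proof. by elim: bs => [|[] bs IH] //=; rewrite IH doubleS. Qed.

Lemma bval_bits v : bval (bits v) = v.
Proof. by elim: v => //= v IH; rewrite bval_binc IH. Qed.

Lemma bval_lt bs : bval bs < 2 ^ size bs.
Proof.
elim: bs => [|d bs IH] //=; rewrite expnS mul2n -ltn_half_double.
by rewrite halfD odd_double doubleK andbF addnA; case: d.
Qed.

Lemma bval_ge (d : bool) bs : last d bs -> 2 ^ size bs <= bval (d :: bs).
Proof.
elim: bs d => [[]|d' bs IH d] //= /IH le; apply: leq_trans (leq_addl _ _).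
by rewrite expnS mul2n leq_double.
Qed.

Lemma last_binc bs (d : bool) : last true bs -> last d (binc bs).
Proof. by elim: bs d => [|[] bs IH] d //= H; [apply: IH|case: bs {IH} H]. Qed.

(** Without leading zeros the length of a numeral is logarithmic in its value; the default [true]
    covers the empty numeral. *)
Lemma last_bits v : last true (bits v).
Proof. by elim: v => //= v IH; apply: last_binc. Qed.

Lemma size_bits_gt v : v < 2 ^ size (bits v).
Proof. by rewrite -{1}(bval_bits v) bval_lt. Qed.

Lemma size_binc bs : size bs <= size (binc bs).
Proof. by elim: bs => [|[] bs IH]. Qed.

Lemma size_bits_le v v' : v <= v' -> size (bits v) <= size (bits v').
Proof.
move=> le; rewrite -(subnK le); elim: (v' - v) => //= d IH.
exact: leq_trans IH (size_binc _).
Qed.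

Lemma size_bits_gt0 v : 0 < size (bits v.+1).
Proof. exact: leq_trans (size_bits_le (ltn0Sn v)). Qed.

Lemma size_bits_lower v : 0 < v -> 2 ^ (size (bits v)).-1 <= v.
Proof.
case: v => // v _; have := size_bits_gt0 v; rewrite -{3}(bval_bits v.+1).
have := last_bits v.+1.
by case: (bits v.+1) => //= d bs H _; apply: bval_ge.
Qed.

(* Each bit of the numeral for n + 2 is followed by C filler cells. *)
Definition num_cells (C n : nat) : nat := C.+1 * size (bits n.+2).

Lemma nth_cat_mid A (a0 : A) p a q : nth a0 (p ++ a :: q) (size p) = a.
Proof. by rewrite nth_cat ltnn subnn. Qed.

Lemma write_cat A (a0 : A) p a a' q :
  write (nth a0 (p ++ a :: q)) (size p) a' = nth a0 (rcons p a' ++ q).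
Proof.
apply: functional_extensionality => i; rewrite /write cat_rcons !nth_cat.
case: eqP => [->|/eqP ne]; first by rewrite ltnn subnn.
case: ltnP => // le; case E: (i - size p) => [|j] //=.
by move/eqP: E; rewrite subn_eq0 => le'; rewrite eqn_leq le le' in ne.
Qed.

Lemma write_end A (a0 : A) p a' :
  write (nth a0 p) (size p) a' = nth a0 (rcons p a').
Proof.
apply: functional_extensionality => i; rewrite /write nth_rcons.
case: eqP => [->|_]; first by rewrite ltnn.
by case: ltnP => // le; rewrite nth_default.
Qed.

Section Setup.
Variables (M : machine) (C b : nat) (x : seq bool) (a : nat -> bool).
Notation S := (simulator M C b).
Notation n := (size x).
Notation sym := (tape_symbol (cell M b)).

Definition groups (bs : seq bool) : seq sym :=
  flatten [seq Count (Some d) :: nseq C (Count None) | d <- bs].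

Notation T := (num_cells C n).
Notation reachS := (reach x (@in_space M C b T)).
Notation conf st ip pos l := (@Config S st ip pos (nth Blank l) 0 a).

Lemma groups_cons d bs :
  groups (d :: bs) = Count (Some d) :: nseq C (Count None) ++ groups bs.
Proof. by []. Qed.

Lemma size_groups bs : size (groups bs) = C.+1 * size bs.
Proof.
rewrite size_flatten /shape -map_comp /comp /=.
by elim: bs => [|d bs IH] /=; rewrite ?muln0 // IH size_nseq mulnS.
Qed.

Lemma in_space0 st ip pos wt : pos <= T.+1 -> in_space T
  (@Config S st ip pos wt 0 a).
Proof. by move=> le; split=> //=; rewrite ?expn_gt0. Qed.

Lemma grow_run ip m (j : 'I_C.+1) p : ip <= n.+1 -> C - j = m ->
  size p + m <= T.+1 ->
  reachS (conf (SGrow M j) ip (size p) p)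
    (conf (SBack M C) ip (size p + m).-1 (p ++ nseq m (Count None))).
Proof.
move=> le_ip; elim: m j p => [|m IH] j p Em le_p.
  have Ej : j = ord_max.
    by apply/val_inj/eqP; rewrite eqn_leq -ltnS ltn_ord /= -subn_eq0 Em.
  rewrite addn0 in le_p; apply: reach_step; first exact: in_space0.
  rewrite (@step_trans S _ _ (SBack M C) ip _ _ _ _ (nth Blank p (size p))
    (a 0) Stay MoveL Stay) //; last first.
    by rewrite /= Ej eqxx.
  rewrite !write_id (minn_idPl le_ip) cats0 addn0; apply: reach_refl.
  by apply: in_space0 => /=; apply: leq_trans (leq_pred _) _.
have ltj : j < C by rewrite -subn_gt0 Em.
apply: reach_step; first by apply: in_space0; apply: leq_trans (leq_addr _ _) le_p.
rewrite (@step_trans S _ _ (SGrow M (ordS j)) ip _ _ _ _ (Count None)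
  (a 0) Stay MoveR Stay) //; last first.
  by rewrite /= -val_eqE /= (ltn_eqF ltj).
rewrite write_id (minn_idPl le_ip) write_end.
have := IH (ordS j) (rcons p (Count None)); rewrite size_rcons addSnnS cat_rcons;
  apply=> //.
by rewrite /= modn_small ?ltnS // subnS Em.
Qed.

Lemma skip_run ip m p q : ip <= n.+1 -> size p + m <= T.+1 ->
  reachS (conf (SInc M C) ip (size p) (p ++ nseq m (Count None) ++ q))
    (conf (SInc M C) ip (size p + m) (p ++ nseq m (Count None) ++ q)).
Proof.
move=> le_ip; elim: m p => [|m IH] p le_p.
  by rewrite addn0; apply: reach_refl; apply: in_space0; rewrite addn0 in le_p.
apply: reach_step; first by apply: in_space0; apply: leq_trans (leq_addr _ _) le_p.
rewrite (@step_trans S _ _ (SInc M C) ip _ _ _ _ (Count None)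
  (a 0) Stay MoveR Stay) //; last first.
  by rewrite nth_cat_mid.
rewrite write_id (minn_idPl le_ip) write_cat.
have := IH (rcons p (Count None)); rewrite size_rcons addSnnS -cat_rcons; exact.
Qed.

(** Only a carry past the last bit lengthens the tape, by a new bit and its [C] fillers. *)
Lemma inc_run ip bs p : ip <= n.+1 -> size p + size (groups (binc bs)) <= T.+1 ->
  exists2 pos, pos <= T.+1 &
  reachS (conf (SInc M C) ip (size p) (p ++ groups bs))
    (conf (SBack M C) ip pos (p ++ groups (binc bs))).
Proof.
move=> le_ip; elim: bs p => [|[] bs IH] p.
- rewrite /groups /= !cats0 size_nseq addnS -addSn => le_p.
  have le_p' : size p <= T.+1 by apply: leq_trans le_p;
    rewrite addSn ltnW // ltnS leq_addr.
  exists (size p + C); first by apply: leq_trans le_p; rewrite addSn.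
  apply: reach_step; first exact: in_space0.
  rewrite (@step_trans S _ _ (SGrow M ord0) ip _ _ _ _ (Count (Some true))
    (a 0) Stay MoveR Stay) //; last first.
    by rewrite nth_default.
  rewrite write_id (minn_idPl le_ip) write_end.
  have := @grow_run ip C ord0 (rcons p (Count (Some true))) le_ip.
  by rewrite size_rcons cat_rcons /= subn0; apply.
- rewrite [binc _]/= !groups_cons [size (_ :: _)]/= size_cat size_nseq.
  rewrite addnS -addSn addnA => le_p.
  have le_p' : (size p).+1 + C <= T.+1 by apply: leq_trans le_p; apply: leq_addr.
  have [|pos le_pos R] := IH (rcons p (Count (Some false)) ++ nseq C (Count None)).
    by rewrite size_cat size_rcons size_nseq.
  exists pos => //; apply: reach_step.
    by apply: in_space0; apply: leq_trans le_p';
      rewrite addSn ltnW // ltnS leq_addr.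
  rewrite (@step_trans S _ _ (SInc M C) ip _ _ _ _ (Count (Some false))
    (a 0) Stay MoveR Stay) //; last first.
    by rewrite nth_cat_mid.
  rewrite write_id (minn_idPl le_ip) write_cat.
  have := @skip_run ip C (rcons p (Count (Some false))) (groups bs) le_ip.
  rewrite size_rcons => /(_ le_p') R'; apply: reach_trans R' _.
  by move: R; rewrite size_cat size_rcons size_nseq -!catA !cat_rcons.
- rewrite [binc _]/= !groups_cons => le_p.
  have le_p' : size p <= T.+1 by apply: leq_trans le_p; apply: leq_addr.
  exists (size p).-1; first by apply: leq_trans (leq_pred _) _.
  apply: reach_step; first exact: in_space0.
  rewrite (@step_trans S _ _ (SBack M C) ip _ _ _ _ (Count (Some true))
    (a 0) Stay MoveL Stay) //; last first.
    by rewrite nth_cat_mid.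
  rewrite write_id (minn_idPl le_ip) write_cat cat_rcons.
  by apply: reach_refl; apply: in_space0; apply: leq_trans (leq_pred _) _.
Qed.

Definition is_count (s : sym) := if s is Count _ then true else false.

Lemma groups_count bs : all is_count (groups bs).
Proof. by elim: bs => //= d bs IH; rewrite all_cat all_nseq orbT. Qed.

Lemma nth_groups_count bs i : i < size (groups bs) -> is_count (nth Blank
  (groups bs) i).
Proof. by move=> lti; apply: (allP (groups_count bs)); apply: mem_nth. Qed.

Lemma back_run ip pos bs : ip <= n.+1 -> pos <= T.+1 ->
  reachS (conf (SBack M C) ip pos (LMark :: groups bs))
    (conf (SBack M C) ip 0 (LMark :: groups bs)).
Proof.
move=> le_ip; elim: pos => [|pos IH] le_pos; first by apply: reach_refl;
  apply: in_space0.
apply: reach_step; first exact: in_space0.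
rewrite (@step_trans S _ _ (SBack M C) ip _ _ _ _ (nth Blank (groups bs) pos)
  (a 0) Stay MoveL Stay) //; last first.
  case: (ltnP pos (size (groups bs))) => lp /=; last by rewrite nth_default.
  by case: nth (nth_groups_count lp).
rewrite write_id (minn_idPl le_ip).
have -> : write (nth Blank (LMark :: groups bs)) pos.+1 (nth Blank
  (groups bs) pos) = nth Blank (LMark :: groups bs).
  exact: (write_id (nth Blank (LMark :: groups bs)) pos.+1).
exact: IH (ltnW le_pos).
Qed.

(** The numeral is incremented once per input cell, both end markers included, whence [n.+2] at the
    right end. *)
Lemma count_run i : i <= n.+1 ->
  reachS (@Config S (SInit M C) 0 0 (fun=> Blank) 0 a)
    (conf (SBack M C) i 0 (LMark :: groups (bits i.+1))).
Proof.
have fit j : j <= n.+1 -> size [:: (LMark :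
  sym)] + size (groups (bits j.+1)) <= T.+1.
  by move=> lej; rewrite size_groups [size [:: _]]/= add1n ltnS leq_pmul2l //
    size_bits_le.
elim: i => [|i IH] le_i.
  have [//||pos le_pos R] := @inc_run 0 [::] [:: LMark]; first exact: fit 0 _.
  apply: reach_trans _ (back_run (bits 1) (leq0n _) le_pos).
  apply: reach_step; first exact: in_space0.
  rewrite (@step_trans S _ _ (SInc M C) 0 _ _ _ _ LMark (a 0) Stay MoveR Stay) //.
  rewrite write_id /= min0n (_ : write _ _ _ = nth Blank [:: LMark]);
    first exact: R.
  by apply: functional_extensionality => -[|j] //=; rewrite nth_nil.
apply: reach_trans (IH (ltnW le_i)) _.
have [//||pos le_pos R] := @inc_run i.+1 (bits i.+1) [:: LMark];
  first exact: fit i.+1 _.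
apply: reach_trans _ (back_run (bits i.+2) le_i le_pos).
apply: reach_step; first exact: in_space0.
rewrite (@step_trans S _ _ (SInc M C) i _ _ _ _ LMark (a 0) MoveR MoveR Stay) //;
  last first.
  by rewrite /=; case: i le_i {IH R} => //= i; rewrite !ltnS => ->.
rewrite write_id /= (minn_idPl le_i).
have -> : write (nth Blank (LMark :: groups (bits i.+1))) 0 LMark =
  nth Blank (LMark :: groups (bits i.+1)).
  exact: (write_id (nth Blank (LMark :: groups (bits i.+1))) 0).
exact: R.
Qed.

Lemma rewind_run ip bs : ip <= n.+1 ->
  reachS (conf (SRewind M C) ip 0 (LMark :: groups bs))
    (conf (SConv M C true) 0 1 (LMark :: groups bs)).
Proof.
have Ew : write (nth Blank (LMark :: groups bs)) 0 LMark =
  nth Blank (LMark :: groups bs).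
  exact: (write_id (nth Blank (LMark :: groups bs)) 0).
elim: ip => [|ip IH] le_ip; (apply: reach_step; first exact: in_space0).
  rewrite (@step_trans S _ _ (SConv M C true) 0 _ _ _ _ LMark
    (a 0) Stay MoveR Stay) //.
  by rewrite write_id Ew /= min0n; apply: reach_refl; apply: in_space0.
rewrite (@step_trans S _ _ (SRewind M C) ip.+1 _ _ _ _ LMark
  (a 0) MoveL Stay Stay) //; last first.
  by rewrite /=; case: (ip < n).
rewrite write_id Ew /= (minn_idPl (ltnW le_ip)); exact: IH (ltnW le_ip).
Qed.

Definition half_converted (m : nat) : nat -> sym := fun j =>
  if j is i.+1 then
    if i < m then Cell (cells b (fun=> blank M) 0 0 0 i)
    else nth Blank (groups (bits n.+2)) i
  else LMark.

Lemma dig0 d i : dig d 0 i = ord0.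
Proof. by apply: val_inj; rewrite /= div0n mod0n. Qed.

Lemma conv_run m : m <= T ->
  reachS (conf (SConv M C true) 0 1 (LMark :: groups (bits n.+2)))
    (@Config S (SConv M C (m == 0)) 0 m.+1 (half_converted m) 0 a).
Proof.
elim: m => [|m IH] le_m.
  rewrite (_ : half_converted 0 = nth Blank (LMark :: groups (bits n.+2))).
    by apply: reach_refl; apply: in_space0.
  by apply: functional_extensionality => -[|i].
apply: reach_trans (IH (ltnW le_m)) _; apply: reach_step.
  by apply: in_space0; apply: ltnW.
rewrite (@step_trans S _ _ (SConv M C false) 0 _ _ _ _ (Cell (cells b
  (fun=> blank M) 0 0 0 m)) (a 0) Stay MoveR Stay) //; last first.
  rewrite /= ltnn; have : m < size (groups (bits n.+2)) by rewrite size_groups.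
  by move/nth_groups_count; case: nth => // o _; rewrite /cells !dig0.
rewrite write_id /= min0n (_ : write _ _ _ = half_converted m.+1);
  first by apply: reach_refl; apply: in_space0.
apply: functional_extensionality => -[|i] //=; rewrite /write eqSS /=.
by rewrite [in RHS]ltnS [in RHS]leq_eqVlt; case: eqP => [->|].
Qed.

(** After the conversion, a pair of sweeps that changes nothing collects the first summary. *)
Theorem setup_run : exists ops,
  reachS (@Config S (SInit M C) 0 0 (fun=> Blank) 0 a)
    (checkpoint C b T ops PCheck None ord0 (start_cfg M a) 0).
Proof.
have T_gt0 : 0 < T by rewrite muln_gt0 size_bits_gt0.
have [||||||ops R] := @sweep M C b x T (control0 M) (blank M) (None, None, None)
  (fun=> blank M) 0 0 0 0 a => //=; first by rewrite expn_gt0.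
exists ops; apply: reach_trans (count_run (leqnn _)) _.
apply: reach_step; first exact: in_space0.
rewrite (@step_trans S _ _ (SRewind M C) n.+1 _ _ _ _ LMark
  (a 0) Stay Stay Stay) //; last first.
  by rewrite /= ltnn.
rewrite write_id /= minnn.
have -> : write (nth Blank (LMark :: groups (bits n.+2))) 0 LMark =
  nth Blank (LMark :: groups (bits n.+2)).
  exact: (write_id (nth Blank (LMark :: groups (bits n.+2))) 0).
apply: reach_trans (rewind_run _ (leqnn _)) _.
apply: reach_trans (conv_run (leqnn T)) _.
apply: reach_step; first exact: in_space0.
have EB : half_converted T T.+1 = Blank by rewrite /= ltnn nth_default //
  size_groups.
rewrite (@step_trans S _ _ (SLeft C (control0 M, blank M,
  (None, None, None), false)) 0 _ _ _ _ Blank (a 0) Stay MoveL Stay) //; last first.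
  by rewrite EB.
have Ew : write (half_converted T) T.+1 Blank =
  layout T (cells b (fun=> blank M) 0 0 0).
  rewrite -EB write_id; apply: functional_extensionality => -[|i] //=.
  by case: ltnP => // le; rewrite nth_default // size_groups.
rewrite write_id /= min0n Ew; move: R.
by rewrite /= (write_id (fun=> blank M) 0).
Qed.

End Setup.

(** * The theorem *)

Lemma num_cells_gt0 C n : 0 < num_cells C n.
Proof. by rewrite muln_gt0 size_bits_gt0. Qed.

Lemma num_cells_ge s : O_log s -> exists C, forall n, s n <= num_cells C n.
Proof.
(* The maximum covers the finitely many lengths below [n0], where it suffices that the numeral is
   not empty. *)
move=> [c [n0 Hs]]; exists (maxn c (\max_(i < n0) s i)) => n.
have [le_n|lt_n] := leqP n0 n.
  apply: leq_trans (Hs _ le_n) _; apply: leq_mul; first exact: leqW (leq_maxl _ _).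
  case: n {Hs le_n} => [|n]; first by rewrite trunc_log0.
  rewrite -(leq_exp2l _ _ (ltnSn 1)).
  apply: leq_trans (trunc_logP (ltnSn 1) (ltn0Sn n)) _.
  by apply: leq_trans (ltnW (size_bits_gt _)); rewrite -addn2 leq_addr.
apply: leq_trans (leq_pmulr _ (size_bits_gt0 _)).
apply: leqW; apply: leq_trans (leq_maxr _ _).
exact: (leq_bigmax (Ordinal lt_n)).
Qed.

Lemma num_cells_O_log C : O_log (fun n => (num_cells C n).+2).
Proof.
(* For [2 <= n] the numeral has at most [l.+2 <= 3 * l] bits; the remaining [2 * l] pays for the two
   extra cells. *)
exists (3 * C.+1 + 2), 2 => n le2n; set l := trunc_log 2 n.
have n_gt0 : 0 < n by apply: leq_trans le2n.
have l_gt0 : 0 < l by rewrite trunc_log_gt0.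
have le_bits : size (bits n.+2) <= l.+2.
  have lt : 2 ^ (size (bits n.+2)).-1 < 2 ^ l.+2.
    apply: leq_ltn_trans (size_bits_lower (ltn0Sn _)) _.
    have := trunc_log_ltn n (ltnSn 1); rewrite -/l => lt_n.
    rewrite expnS mul2n -addnn -addn2; apply: leq_ltn_trans (leq_add
      (leqnn n) le2n) _.
    by rewrite -addnS leq_add // ltnW.
  rewrite ltn_exp2l // in lt; by case: (size _) lt.
rewrite mulnDl -addn2; apply: leq_add; last by rewrite leq_pmulr.
rewrite /num_cells -mulnA mulnCA leq_mul2l /=; apply: leq_trans le_bits _.
by rewrite -addn2 (mulSn 2) leq_add2l -[X in X <= _](muln1 2) leq_mul.
Qed.

(** Origin of the base [4 ^ k.+1]: since [(2 ^ m).+1 <= 4 ^ T], a counter of [T] such digits has a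
    factor [4 ^ T] to spare. *)
Lemma visits_bound k m T : 0 < T -> m <= T ->
  (2 ^ m).+1 ^ k < (4 ^ k.+1).-1.+1 ^ T.
Proof.
move=> T_gt0 le_mT; rewrite prednK ?expn_gt0 // -expnM mulSn mulnC expnD.
have le4 : (2 ^ m).+1 <= 4 ^ T.
  rewrite -[4]/(2 * 2) expnMn; apply: leq_ltn_trans (leq_pexp2l (ltn0Sn 1) le_mT) _.
  by rewrite -[X in X < _]muln1 ltn_pmul2l ?expn_gt0 // -{1}(expn0 2) ltn_exp2l.
apply: leq_ltn_trans (_ : (4 ^ T) ^ k < _); first by case: k => // k;
  rewrite leq_exp2r.
rewrite mulnC expnM -[X in X < _]muln1 ltn_pmul2l ?expn_gt0 ?expn_gt0 //.
by rewrite -{1}(expn0 4) ltn_exp2l.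
Qed.

Section Simulation.
Variables (k : nat) (M : machine) (s : nat -> nat) (C : nat).
Hypothesis LM : lossy_catalytic_TM k M s (fun n => 2 ^ s n).
Hypothesis le_s : forall n, s n <= num_cells C n.
Notation sim := (simulator M C (4 ^ k.+1).-1).
Notation space := (fun n => (num_cells C n).+2).

Theorem simulator_run x (w : (2 ^ space (size x)).-tuple bool) : exists v,
  [/\ exists t, verdict (cstate (run M x (pre s x (nth false w)) t)) = Some v,
      exists t, verdict (cstate (run sim x w t)) = Some v /\
                aux_tape (run sim x w t) = nth false w
    & forall t, work_pos (run sim x w t) < space (size x) /\
                aux_pos (run sim x w t) < 2 ^ space (size x)].
Proof.
set a := nth false w; set T := num_cells C (size x).
have T_gt0 : 0 < T := num_cells_gt0 _ _.
have [N [v [VN Vi cnt Vt]]] := tour_search LM (le_s (size x)) a.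
have [ops R1] := setup_run M C (4 ^ k.+1).-1 x a.
have [|tm [R2 Vtm Atm]] := @walk_sim M C (4 ^ k.+1).-1 x T T_gt0 a ops ord0 _ N v
  (start_wf LM (le_s (size x)) a) (is_start_start M T a) VN Vi.
  exact: leq_ltn_trans cnt (visits_bound _ T_gt0 (le_s _)).
have [[t Et] space_ok] := reach_iter (reach_trans R1 R2) Vtm.
exists v; split=> //; exists t; rewrite -[run _ _ _ _]/(iter t _ _).
by rewrite -[init _ _]/(@Config sim (SInit M C) 0 0 (fun=> Blank) 0 a) Et.
Qed.

Lemma verdict_unique (M' : machine) x (w : seq bool) t t' v v' :
  verdict (cstate (run M' x w t)) = Some v ->
  verdict (cstate (run M' x w t')) = Some v' -> v = v'.
Proof. by move=> V V'; have E := halted_unique V V'; move: V';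
  rewrite /run -E -/(run _ _ _ t) V => -[]. Qed.

Lemma simulator_verdict x v :
  (forall w : (2 ^ s (size x)).-tuple bool,
     exists t, verdict (cstate (run M x w t)) = Some v) ->
  forall w : (2 ^ space (size x)).-tuple bool,
     exists t, verdict (cstate (run sim x w t)) = Some v.
Proof.
move=> H w; have [v' [[t V] [t' [V' _]] _]] := simulator_run w.
have [t0 V0] := H (pre s x (nth false w)).
by exists t'; rewrite V' (verdict_unique V0 V).
Qed.

Theorem simulator_catalytic : catalytic_TM sim space (fun n => 2 ^ space n).
Proof.
split.
- by move=> x w t; have [v [_ _]] := simulator_run w; apply.
- move=> x w; have [v [_ [t [V A]] _]] := simulator_run w.
  exists t; split; first by exists v.
  apply: eq_from_tnth => i; rewrite tnth_mktuple A; exact/esym/tnth_nth.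
- move=> x; have [_ _ /(_ x) [acc|rej]] := LM; [left|right];
    exact: simulator_verdict.
Qed.

Theorem simulator_decides L : decides M (fun n => 2 ^ s n) L ->
  decides sim (fun n => 2 ^ space n) L.
Proof.
move=> DL x; split=> [/DL|acc]; first exact: simulator_verdict.
apply/DL; have [_ _ /(_ x) [//|rej]] := LM.
pose w : (2 ^ space (size x)).-tuple bool := [tuple false | i < _].
have [t V] := acc w; have [t' V'] := simulator_verdict rej w.
by have := verdict_unique V V'.
Qed.

End Simulation.

Theorem mainTheorem1 (k : nat) : forall L : language, LCL k L <-> CL L.
Proof.
move=> L; split=> [[s [Os [M [LM DM]]]]|[s [Os [M [[SB CM cons] DM]]]]].
  have [C le_s] := num_cells_ge Os.
  exists (fun n => (num_cells C n).+2); split; first exact: num_cells_O_log.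
  exists (simulator M C (4 ^ k.+1).-1).
  by split; [apply: simulator_catalytic LM le_s|apply: simulator_decides LM le_s _
    DM].
exists s; split=> //; exists M; split=> //; split=> // x w.
(* A restored tape is at distance 0, within any [k]. *)
have [t [H E]] := CM x w; exists t; split=> //; rewrite E /hamming.
by rewrite (_ : [set i | _] = set0) ?cards0 //; apply/setP => i; rewrite !inE eqxx.
Qed.
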